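(* Let $P$ be a centrally symmetric hyperbolic polygon with $2m$ sides, satisfying the cycle condition, and let $S := \{g_1, \dots, g_{2m}\}$ be the set of hyperbolic translations identifying opposite sides of $P$. Then $$\sum_{g \in S} \frac{1}{1 + e^{\ell(g)}} < 1,$$ where $\ell(g)$ denotes the translation length of $g$ in the hyperbolic metric.
   Context: Polygons are convex, compact polygons with geodesic sides in the hyperbolic disk $\mathbb{D}$ (a model of $\mathbb{H}^2$, curvature $-1$). A polygon $P$ with $2m$ sides is centrally symmetric if there is a point $o \in \mathbb{D}$ such that $P$ is invariant under the reflection across the point $o$ (rotation by $\pi$ about $o$); then opposite sides have equal length and opposite angles are equal. Let $\gamma_1, \dots, \gamma_{2m}$ be the interior angles in cyclic order. $P$ satisfies the cycle condition if there is an integer $k \geq 1$ such that $\sum_{i=1}^m \gamma_{2i} = \sum_{i=1}^m \gamma_{2i-1} = \frac{2\pi}{k}$. The hyperbolic translation identifying a side with its opposite side is the orientation-preserving isometry taking the side $s_i$ to the opposite side $s_{i+m}$ (indices mod $2m$) and equal to the composition of the point reflection at the midpoint of $s_i$ followed by the point reflection at the center $o$; $S$ consists of these $2m$ translations (so it is closed under inverses). The translation length is $\ell(g) := \lim_{n\to\infty} \frac{d_{\mathbb{H}}(o, g^n o)}{n}$. *)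

(* Defs.v *)
From mathcomp Require Import all_boot all_order all_algebra.
From mathcomp Require Import complex ring lra.
From mathcomp Require Import all_classical all_reals all_analysis.
Set Implicit Arguments.
Unset Strict Implicit.
Unset Printing Implicit Defensive.
Import Order.TTheory GRing.Theory Num.Theory.
Import numFieldNormedType.Exports.
Local Open Scope classical_set_scope.
Local Open Scope ring_scope.
Local Open Scope complex_scope.

(* Real-valued modulus; the library's `|z| lives in R[i]. *)
Definition cmod (R : realType) (z : R[i]) : R :=
  Num.sqrt (complex.Re z ^+ 2 + complex.Im z ^+ 2).

Definition disk (R : realType) : set R[i] := [set z | cmod z < 1].

(* For a in the disk this is the orientation-preserving isometry of the disk
   sending a to 0 with positive derivative at a; its inverse is mobius (- a).
   Isometries are total functions on R[i], only their values on the disk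
   matter. *)
Definition mobius (R : realType) (a z : R[i]) : R[i] :=
  (z - a) / (1 - a^*%C * z).

(* Curvature -1: the distance is 2 artanh |mobius z w|. *)
Definition hdist (R : realType) (z w : R[i]) : R :=
  ln ((1 + cmod (mobius z w)) / (1 - cmod (mobius z w))).

(* Rotation by pi about p: conjugate of z |-> - z. *)
Definition point_reflection (R : realType) (p z : R[i]) : R[i] :=
  mobius (- p) (- mobius p z).

(* With u := mobius a b and |u| = tanh (d / 2), the midpoint of [0, u] is
   tanh (d / 4) u / |u| = u / (1 + sqrt (1 - |u|^2)); see [hdist_hmid]. *)
Definition hmid (R : realType) (a b : R[i]) : R[i] :=
  mobius (- a)
    (mobius a b / (1 + Num.sqrt (1 - cmod (mobius a b) ^+ 2))%:C).

(* mobius a sends the geodesic from a to b to a diameter, so this is positive,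
   zero or negative according to whether z is to the left of, on, or to the
   right of the complete geodesic directed from a to b. *)
Definition hside (R : realType) (a b z : R[i]) : R :=
  complex.Im (mobius a z * (mobius a b)^*%C).

(* v lists in counterclockwise order the vertices of a convex polygon with n
   sides [v i, v (i + 1)], indices modulo n: each side has all the other
   vertices strictly on its left. *)
Definition convex_polygon (R : realType) (n : nat) (v : 'I_n -> R[i]) : Prop :=
  [/\ (2 < n)%N,
      forall i, disk (v i) &
      forall i j, j != i -> j != ordS i -> 0 < hside (v i) (v (ordS i)) (v j)].

Definition polygon_region (R : realType) (n : nat) (v : 'I_n -> R[i]) :
    set R[i] :=
  [set z | disk z /\ forall i, 0 <= hside (v i) (v (ordS i)) z].

Definition symmetric_about (R : realType) (P : set R[i]) (o : R[i]) : Prop :=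
  disk o /\ point_reflection o @` P = P.

(* Angle at p between the geodesics from p to a and from p to b: mobius p is
   conformal and sends them to Euclidean segments issuing from 0. *)
Definition hangle (R : realType) (a p b : R[i]) : R :=
  acos (complex.Re (mobius p a * (mobius p b)^*%C)
        / (cmod (mobius p a) * cmod (mobius p b))).

Definition interior_angle (R : realType) (n : nat) (v : 'I_n -> R[i])
    (i : 'I_n) : R :=
  hangle (v (ord_pred i)) (v i) (v (ordS i)).

Definition cycle_condition (R : realType) (m : nat)
    (v : 'I_(2 * m) -> R[i]) : Prop :=
  exists2 k : nat, (1 <= k)%N &
    \sum_(i < 2 * m | ~~ odd i) interior_angle v i = 2 * pi / k%:R /\
    \sum_(i < 2 * m | odd i) interior_angle v i = 2 * pi / k%:R.

(* When o is the center of symmetry, this is the translation taking the side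
   [v i, v (i + 1)] to the opposite side. *)
Definition side_translation (R : realType) (n : nat) (v : 'I_n -> R[i])
    (o : R[i]) (i : 'I_n) : R[i] -> R[i] :=
  point_reflection o \o point_reflection (hmid (v i) (v (ordS i))).

Definition side_translations (R : realType) (n : nat) (v : 'I_n -> R[i])
    (o : R[i]) : set (R[i] -> R[i]) :=
  range (side_translation v o).

Definition translation_length (R : realType) (o : R[i]) (g : R[i] -> R[i]) : R :=
  limn (fun n : nat => hdist o (iter n g o) / n%:R).

Lemma ofRI (R : realType) (x y : R) : x%:C = y%:C -> x = y.
Proof. by case. Qed.

Lemma cmodE (R : realType) (z : R[i]) : (cmod z)%:C = `|z|.
Proof. by rewrite normc_def. Qed.

Lemma cmodM (R : realType) (x y : R[i]) : cmod (x * y) = cmod x * cmod y.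
Proof. by apply: ofRI; rewrite rmorphM /= !cmodE normrM. Qed.

Lemma cmodV (R : realType) (x : R[i]) : cmod x^-1 = (cmod x)^-1.
Proof. by apply: ofRI; rewrite fmorphV /= !cmodE normfV. Qed.

Lemma cmodJ (R : realType) (x : R[i]) : cmod x^*%C = cmod x.
Proof. by apply: ofRI; rewrite !cmodE normcJ. Qed.

Lemma cmodN (R : realType) (x : R[i]) : cmod (- x) = cmod x.
Proof. by apply: ofRI; rewrite !cmodE normrN. Qed.

Lemma cmod_ge0 (R : realType) (x : R[i]) : 0 <= cmod x.
Proof. exact: sqrtr_ge0. Qed.

Lemma cmod_real (R : realType) (t : R) : 0 <= t -> cmod t%:C = t.
Proof. by move=> t0; rewrite /cmod /= expr0n addr0 sqrtr_sqr ger0_norm. Qed.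

Lemma cmod_sqr (R : realType) (x : R[i]) : (cmod x ^+ 2)%:C = x * x^*%C.
Proof. by rewrite rmorphXn /= cmodE sqr_normc. Qed.

Lemma disk_den_neq0 (R : realType) (a z : R[i]) :
  disk a -> disk z -> 1 + a * z != 0.
Proof.
rewrite /disk /= => a1 z1; apply/eqP => h.
have e : a * z = -1 by apply/eqP; rewrite -addr_eq0 addrC h.
have : cmod (a * z) = 1.
  by rewrite e; apply: ofRI; rewrite cmodE normrN1.
rewrite cmodM => h1; have := cmod_ge0 a; have := cmod_ge0 z; nra.
Qed.

Lemma diskJ (R : realType) (a : R[i]) : disk a -> disk a^*%C.
Proof. by rewrite /disk /= cmodJ. Qed.

Lemma diskN (R : realType) (a : R[i]) : disk a -> disk (- a).
Proof. by rewrite /disk /= cmodN. Qed.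

Lemma mobius_disk (R : realType) (a z : R[i]) :
  disk a -> disk z -> disk (mobius a z).
Proof.
move=> da dz; have d := disk_den_neq0 (diskN (diskJ da)) dz.
have {}d : 1 - a^*%C * z != 0 by rewrite -mulNr.
have k : (cmod (1 - a^*%C * z)) ^+ 2 - (cmod (z - a)) ^+ 2
       = (1 - cmod a ^+ 2) * (1 - cmod z ^+ 2).
  apply: ofRI; rewrite rmorphM !rmorphB /= !cmod_sqr !rmorph1.
  rewrite !rmorphB !rmorphM rmorph1 /= conjcK.
  ring.
have p : 0 < cmod (1 - a^*%C * z).
  rewrite lt_neqAle cmod_ge0 andbT eq_sym; apply: contra d => /eqP h.
  by rewrite -normr_eq0 -cmodE h.
rewrite /disk /= /mobius cmodM cmodV ltr_pdivrMr // mul1r.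
move: da dz; rewrite /disk /= => da dz.
have := cmod_ge0 a; have := cmod_ge0 z; have := cmod_ge0 (z - a) => h1 h2 h3.
have : 0 < (1 - cmod a ^+ 2) * (1 - cmod z ^+ 2) by apply: mulr_gt0; nra.
rewrite -k => h4; nra.
Qed.

Lemma mobius_isometry (R : realType) (a x y : R[i]) :
  disk a -> disk x -> disk y ->
  cmod (mobius (mobius a x) (mobius a y)) = cmod (mobius x y).
Proof.
move=> da dx dy.
have nz (u v : R[i]) (du : disk u) (dv : disk v) : 1 - u^*%C * v != 0.
  by rewrite -mulNr; apply: disk_den_neq0 => //; apply/diskN/diskJ.
have e : mobius (mobius a x) (mobius a y)
       = mobius x y * ((1 - a^*%C * x)^*%C / (1 - a^*%C * x)).
  have h1 := nz _ _ da dx; have h2 := nz _ _ da dy.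
  have h3 := nz _ _ dx da; have h4 := nz _ _ dx dy; have h5 := nz _ _ da da.
  rewrite /mobius !fmorph_div !rmorphB !rmorphM !rmorph1 /= conjcK.
  move: h1 h2 h3 h4 h5.
  move: (a^*%C) (x^*%C) => a' x' h1 h2 h3 h4 h5.
  rewrite mulrC in h3; field; rewrite h1 h2 h3 h4 /=.
  have -> : (1 - a * x') * (1 - a' * y) - (x' - a') * (y - a)
          = (1 - a' * a) * (1 - x' * y) by ring.
  exact: mulf_neq0.
rewrite e cmodM cmodM cmodV cmodJ divff ?mulr1 //.
apply: contra (nz _ _ da dx) => /eqP h.
by rewrite -normr_eq0 -cmodE h.
Qed.

Lemma mobius_at0 (R : realType) (z : R[i]) : mobius 0 z = z.
Proof. by rewrite /mobius rmorph0 mul0r !subr0 divr1. Qed.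

Lemma mobius_to0 (R : realType) (a : R[i]) : mobius (- a) 0 = a.
Proof. by rewrite /mobius opprK add0r mulr0 subr0 divr1. Qed.

Lemma mobiusNK (R : realType) (a z : R[i]) :
  disk a -> disk z -> mobius (- a) (mobius a z) = z.
Proof.
move=> da dz.
have h1 : 1 - a^*%C * z != 0 by rewrite -mulNr disk_den_neq0 //; exact/diskN/diskJ.
have h2 : 1 - a^*%C * a != 0 by rewrite -mulNr disk_den_neq0 //; exact/diskN/diskJ.
have := disk_den_neq0 (diskJ da) (mobius_disk da dz).
rewrite /mobius rmorphN /= opprK mulNr opprK.
move: h1 h2; move: (a^*%C) => a' h1 h2 h3.
have h4 : 1 - a' * z + a' * (z - a) != 0.
  by rewrite (_ : _ + _ = 1 - a' * a) //; ring.
by field; rewrite ?h1 ?h2 ?h4.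
Qed.

Lemma hdist_isometry (R : realType) (a x y : R[i]) :
  disk a -> disk x -> disk y -> hdist (mobius a x) (mobius a y) = hdist x y.
Proof. by move=> da dx dy; rewrite /hdist mobius_isometry. Qed.

Lemma hdist_hmid (R : realType) (a b : R[i]) : disk a -> disk b ->
  [/\ disk (hmid a b), hdist a (hmid a b) = hdist a b / 2 &
      hdist (hmid a b) b = hdist a b / 2].
Proof.
move=> da db; have du := mobius_disk da db.
rewrite /hmid; set u := mobius a b in du *.
have -> : hdist a b = hdist 0 u.
  by rewrite /hdist mobius_at0.
have d0 : disk (0 : R[i]).
  by rewrite /disk /= /cmod /= expr0n addr0 sqrtr0 ltr01.
have dna := diskN da.
set r := cmod u; set s := Num.sqrt _.
have r0 : 0 <= r by apply: cmod_ge0.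
have r1 : r < 1 by [].
have ss : s ^+ 2 = 1 - r ^+ 2 by rewrite sqr_sqrtr //; nra.
have s0 : 0 < s by rewrite sqrtr_gt0; nra.
have s1 : 0 < 1 + s by nra.
have ct : cmod (u / (1 + s)%:C) = r / (1 + s).
  by rewrite cmodM cmodV cmod_real // ltW.
have dt : disk (u / (1 + s)%:C).
  by rewrite /disk /= ct ltr_pdivrMr // mul1r; nra.
have cm : cmod (mobius (u / (1 + s)%:C) u) = r / (1 + s).
  have sC : (1 + s)%:C != 0 :> R[i].
    by apply/eqP => /ofRI h; move: s1; rewrite h ltxx.
  have sC' : s%:C != 0 :> R[i].
    by apply/eqP => /ofRI h; move: s0; rewrite h ltxx.
  have -> : mobius (u / (1 + s)%:C) u = u / (1 + s)%:C; last by rewrite ct.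
  have uu : u^*%C * u = 1 - s%:C ^+ 2.
    rewrite mulrC -cmod_sqr -/r -rmorphXn ss rmorphB rmorph1 /=.
    by rewrite opprB addrC subrK.
  have cj : ((1 + s)%:C^*)%C = (1 + s)%:C by rewrite /= oppr0.
  have wE : (1 + s)%:C = 1 + s%:C by rewrite rmorphD rmorph1.
  move: sC sC' cj wE uu; move: (1 + s)%:C (s%:C) => w t w0 t0 cj wE uu.
  have e : 1 - (u / w)^*%C * u = t.
    rewrite fmorph_div /= cj mulrAC uu wE; rewrite wE in w0.
    by field; rewrite w0.
  rewrite /mobius e wE; rewrite wE in w0.
  by field; rewrite w0 t0.
have half : ln ((1 + r / (1 + s)) / (1 - r / (1 + s)))
          = ln ((1 + r) / (1 - r)) / 2.
  have q0 : 0 < (1 + r / (1 + s)) / (1 - r / (1 + s)).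
    have h : r / (1 + s) < 1 by rewrite ltr_pdivrMr // mul1r; nra.
    have h' : 0 <= r / (1 + s) by rewrite divr_ge0 // ltW.
    by apply: divr_gt0; lra.
  have -> : (1 + r) / (1 - r) = ((1 + r / (1 + s)) / (1 - r / (1 + s))) ^+ 2.
    have n1 : 1 - r != 0 by apply: lt0r_neq0; lra.
    have n2 : 1 + s != 0 by apply: lt0r_neq0; lra.
    have n3 : 1 + s - r != 0 by apply: lt0r_neq0; lra.
    have -> : (1 + r / (1 + s)) / (1 - r / (1 + s)) = (1 + s + r) / (1 + s - r).
      by field; rewrite n2 n3.
    rewrite expr_div_n; apply/eqP; rewrite eqr_div ?expf_neq0 //.
    apply/eqP; apply/subr0_eq.
    have -> : (1 + r) * (1 + s - r) ^+ 2 - (1 + s + r) ^+ 2 * (1 - r) =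
       2 * r * (s ^+ 2 - (1 - r ^+ 2)) by ring.
    by rewrite ss subrr mulr0.
  by rewrite lnXn // -[ln _ *+ 2]mulr_natr mulfK // pnatr_eq0.
have -> : hdist 0 u = ln ((1 + r) / (1 - r)) by rewrite /hdist mobius_at0.
rewrite -half; split; first exact: mobius_disk.
- by rewrite -{1}[a]mobius_to0 hdist_isometry // /hdist mobius_at0 ct.
- by rewrite -{1}[b](mobiusNK da db) -/u hdist_isometry // /hdist cm.
Qed.

(* Main.v *)
Require Import Defs.
From mathcomp Require Import all_boot all_order all_algebra.
From mathcomp Require Import complex ring lra zify.
From mathcomp Require Import all_classical all_reals all_analysis.
Set Implicit Arguments.
Unset Strict Implicit.
Unset Printing Implicit Defensive.
Import Order.TTheory GRing.Theory Num.Theory.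
Import numFieldNormedType.Exports.
Local Open Scope classical_set_scope.
Local Open Scope ring_scope.
Local Open Scope complex_scope.

(* Put the center at 0.  A product of two half-turns about points at distance d
   is a translation of length 2 d, so 1 / (1 + e^l) = (1 - T) / 2, where
   T = tanh d is the modulus of the Klein coordinate of the midpoint of the
   side: one must show that the m midpoints of half of the boundary satisfy
   sum (1 - T) < 1.

   The half-turn about the point of Klein coordinate - z acts on the rays of
   R^2 = C by w |-> i (w + z w^* ); its lift to R moves every ray forward by an
   angle in (0, pi).  Following the polygon, the product of the m half-turns and
   of the one about 0 is conjugate to a rotation, whose lifted angle pi + pi / k
   is computed from the angles of the triangles cut out by the center.

   If m = 2 then k >= 3 and the trace gives
   cos (pi / k)^2 (1 - T1^2) (1 - T2^2) <= T1^2 T2^2, so T1 + T2 > 1.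
   If m = 3 then k >= 2 and the trace gives
   z1.z2 + z2.z3 - z1.z3 >= 1, so T1^2 + T2^2 + T3^2 >= 2.
   If m >= 4, one only uses that the lifted product is at most the rotation by
   2 pi.  Two consecutive half-turns dominate a single one with
   T' <= max (0, T1 + T2 - 1), which reduces to four half-turns; for these,
   T1^2 T2^2 + T3^2 T4^2 >= 1 and, cyclically, T2^2 T3^2 + T4^2 T1^2 >= 1. *)

(** * Rays and their angles *)

Local Notation re := complex.Re.
Local Notation im := complex.Im.

Lemma complexP (R : realType) (x y : R[i]) : re x = re y -> im x = im y -> x = y.
Proof. by case: x => a b; case: y => c d /= -> ->. Qed.

Lemma reD (R : realType) (x y : R[i]) : re (x + y) = re x + re y.
Proof. by case: x; case: y. Qed.
Lemma imD (R : realType) (x y : R[i]) : im (x + y) = im x + im y.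
Proof. by case: x; case: y. Qed.
Lemma reN (R : realType) (x : R[i]) : re (- x) = - re x.
Proof. by case: x. Qed.
Lemma imN (R : realType) (x : R[i]) : im (- x) = - im x.
Proof. by case: x. Qed.
Lemma reM (R : realType) (x y : R[i]) : re (x * y) = re x * re y - im x * im y.
Proof. by case: x; case: y. Qed.
Lemma imM (R : realType) (x y : R[i]) : im (x * y) = re x * im y + im x * re y.
Proof. by case: x; case: y. Qed.
Lemma reJ (R : realType) (x : R[i]) : re x^*%C = re x.
Proof. by case: x. Qed.
Lemma imJ (R : realType) (x : R[i]) : im x^*%C = - im x.
Proof. by case: x. Qed.
Lemma re0 (R : realType) : re (0 : R[i]) = 0. Proof. by []. Qed.
Lemma im0 (R : realType) : im (0 : R[i]) = 0. Proof. by []. Qed.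
Lemma re1 (R : realType) : re (1 : R[i]) = 1. Proof. by []. Qed.
Lemma im1 (R : realType) : im (1 : R[i]) = 0. Proof. by []. Qed.
Lemma reC (R : realType) (t : R) : re t%:C = t. Proof. by []. Qed.
Lemma imC (R : realType) (t : R) : im t%:C = 0. Proof. by []. Qed.

Lemma reMn (R : realType) (x : R[i]) n : re (x *+ n) = re x *+ n.
Proof. by elim: n => [|n ih] //; rewrite !mulrS reD ih. Qed.
Lemma imMn (R : realType) (x : R[i]) n : im (x *+ n) = im x *+ n.
Proof. by elim: n => [|n ih] //; rewrite !mulrS imD ih. Qed.

Lemma re_Complex (R : realType) (x y : R) : re (x +i* y) = x. Proof. by []. Qed.
Lemma im_Complex (R : realType) (x y : R) : im (x +i* y) = y. Proof. by []. Qed.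

Definition reimE := (reD, imD, reN, imN, reM, imM, reJ, imJ, re0, im0, re1, im1,
  reC, imC, re_Complex, im_Complex, reMn, imMn).

Ltac cring := apply: complexP; rewrite ?(expr2, reimE); ring.

Lemma cjD (R : realType) (x y : R[i]) : (x + y)^*%C = x^*%C + y^*%C.
Proof. exact: rmorphD. Qed.
Lemma cjM (R : realType) (x y : R[i]) : (x * y)^*%C = x^*%C * y^*%C.
Proof. exact: rmorphM. Qed.
Lemma cjN (R : realType) (x : R[i]) : (- x)^*%C = - x^*%C.
Proof. exact: rmorphN. Qed.
Lemma cj1 (R : realType) : (1 : R[i])^*%C = 1.
Proof. exact: rmorph1. Qed.
Lemma cjC (R : realType) (t : R) : (t%:C)^*%C = t%:C.
Proof. by rewrite /= oppr0. Qed.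
Lemma cji (R : realType) : ('i%C : R[i])^*%C = - 'i%C.
Proof. by cring. Qed.
Definition conjE := (cjD, cjM, cjN, cj1, cjC, cji, conjcK).

Ltac jring := rewrite ?conjE; ring.

Definition sqmod (R : realType) (z : R[i]) : R := re z ^+ 2 + im z ^+ 2.

Lemma sqmodE (R : realType) (z : R[i]) : sqmod z = cmod z ^+ 2.
Proof. by rewrite /sqmod /cmod sqr_sqrtr // addr_ge0 // sqr_ge0. Qed.

Lemma sqmod_ge0 (R : realType) (z : R[i]) : 0 <= sqmod z.
Proof. by rewrite sqmodE sqr_ge0. Qed.

Lemma sqmodM (R : realType) (x y : R[i]) : sqmod (x * y) = sqmod x * sqmod y.
Proof. by rewrite /sqmod !reimE; ring. Qed.

Lemma sqmod_gt0 (R : realType) (z : R[i]) : z != 0 -> 0 < sqmod z.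
Proof.
case: z => x y; rewrite eq_complex /= negb_and => h.
rewrite /sqmod /=; case/orP: h => h.
  by rewrite ltr_pwDl ?sqr_ge0 // exprn_even_gt0.
by rewrite ltr_wpDl ?sqr_ge0 // exprn_even_gt0.
Qed.

Lemma mulcJ (R : realType) (z : R[i]) : z * z^*%C = (sqmod z)%:C.
Proof. by rewrite /sqmod; cring. Qed.

Lemma diskE (R : realType) (z : R[i]) : disk z <-> sqmod z < 1.
Proof.
rewrite /disk /= sqmodE; split => h.
  by rewrite expr_lt1 // cmod_ge0.
by rewrite -(@expr_lt1 _ 2) // cmod_ge0.
Qed.

Lemma cmod0 (R : realType) : cmod (0 : R[i]) = 0.
Proof. by rewrite /cmod /= expr0n addr0 sqrtr0. Qed.

Lemma disk0 (R : realType) : disk (0 : R[i]).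
Proof. by rewrite /disk /mkset cmod0 ltr01. Qed.

Definition cis (R : realType) (t : R) : R[i] := cos t +i* sin t.

(** Angles are real numbers, not classes modulo [pi *+ 2]; this is what lets lifted half-turns be
    compared by order. *)
Definition onray (R : realType) (t : R) (w : R[i]) : Prop :=
  exists2 r : R, 0 < r & w = r%:C * cis t.

Lemma cisD (R : realType) (s t : R) : cis (s + t) = cis s * cis t.
Proof. by rewrite /cis cosD sinD; cring. Qed.

Lemma cisN (R : realType) (t : R) : cis (- t) = (cis t)^*%C.
Proof. by rewrite /cis cosN sinN; cring. Qed.

Lemma onray_cis (R : realType) (t : R) : onray t (cis t).
Proof. by exists 1; rewrite ?ltr01 // mul1r. Qed.

Lemma onrayM (R : realType) (s t : R) (x y : R[i]) :
  onray s x -> onray t y -> onray (s + t) (x * y).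
Proof.
move=> [r r0 ->] [q q0 ->]; exists (r * q); first exact: mulr_gt0.
by rewrite cisD rmorphM /=; ring.
Qed.

Lemma onrayJ (R : realType) (t : R) (x : R[i]) : onray t x -> onray (- t) x^*%C.
Proof. by move=> [r r0 ->]; exists r => //; rewrite cisN; cring. Qed.

Lemma onrayZ (R : realType) (t r : R) (x : R[i]) :
  0 < r -> onray t x -> onray t (r%:C * x).
Proof.
move=> r0 [q q0 ->]; exists (r * q); first exact: mulr_gt0.
by rewrite rmorphM mulrA.
Qed.

Lemma onray_im (R : realType) (t : R) (x : R[i]) : onray t x ->
  exists2 r, 0 < r & im x = r * sin t.
Proof. by move=> [r r0 ->]; exists r => //; rewrite !reimE; ring. Qed.

Lemma onray_re (R : realType) (t : R) (x : R[i]) : onray t x ->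
  exists2 r, 0 < r & re x = r * cos t.
Proof. by move=> [r r0 ->]; exists r => //; rewrite !reimE; ring. Qed.

Lemma onray_pihalf (R : realType) : onray (pi / 2) ('i%C : R[i]).
Proof. by exists 1; rewrite // /cis cos_pihalf sin_pihalf mul1r. Qed.

Lemma onray_pi (R : realType) : onray pi (-1 : R[i]).
Proof. by exists 1; rewrite // /cis cospi sinpi; cring. Qed.

Lemma sin_lt0_pi (R : realType) (t : R) : - pi < t < 0 -> sin t < 0.
Proof.
move=> /andP[h1 h2]; rewrite -(opprK t) sinN oppr_lt0 sin_gt0_pi //.
by apply/andP; split; lra.
Qed.

(** Multiplying [x] by its conjugate puts a positive real on the ray of angle [s - t], so the sine
    vanishes and the cosine is nonnegative. Later angle identities follow this pattern: an algebraic
    identity up to a positive factor, then crude bounds. *)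
Lemma onray_inj (R : realType) (s t : R) (x : R[i]) :
  onray s x -> onray t x -> - (pi *+ 2) < s - t < pi *+ 2 -> s = t.
Proof.
move=> hs ht; wlog st : s t hs ht / t <= s.
  move=> W h; have [/W|/ltW/W] := leP t s; first exact.
  move=> /(_ ht hs) -> //; move: h => /andP[h1 h2]; apply/andP; split; lra.
move=> /andP[_ h]; move: st; rewrite le_eqVlt => /predU1P[-> //|st].
have [r r0] := onrayM hs (onrayJ ht).
rewrite mulcJ => /eqP; rewrite eq_complex /= => /andP[/eqP hc /eqP hi].
have s0 : sin (s - t) = 0.
  by move: hi; rewrite mul0r addr0 => /esym/eqP; rewrite mulf_eq0 gt_eqF //= => /eqP.
have c0 : 0 <= cos (s - t).
  move: hc; rewrite mul0r subr0 => hc.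
  by rewrite -(pmulr_rge0 _ r0) -hc sqmod_ge0.
exfalso; have [h1|h1|h1] := ltgtP (s - t) pi.
- have : 0 < sin (s - t) by rewrite sin_gt0_pi //; apply/andP; split; lra.
  by rewrite s0 ltxx.
- have : sin (s - t - pi *+ 2) < 0.
    by apply: sin_lt0_pi; move: h; rewrite mulr2n => h; apply/andP; split; lra.
  by rewrite -sinD2pi subrK s0 ltxx.
- by move: c0; rewrite h1 cospi; lra.
Qed.

(* The argument of z, only when 0 < re z. *)
Definition argr (R : realType) (z : R[i]) : R := atan (im z / re z).

Lemma argr_bounds (R : realType) (z : R[i]) : - (pi / 2) < argr z < pi / 2.
Proof. by rewrite atan_gtNpi2 atan_ltpi2. Qed.

Lemma onray_argr (R : realType) (z : R[i]) : 0 < re z -> onray (argr z) z.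
Proof.
move=> h; have c0 : 0 < cos (argr z) by rewrite cos_gt0_pihalf // argr_bounds.
exists (re z / cos (argr z)); first exact: divr_gt0.
have : tan (argr z) = im z / re z by rewrite atanK.
rewrite /tan => ht.
have hs : sin (argr z) = im z / re z * cos (argr z).
  by rewrite -ht divfK // gt_eqF.
apply: complexP; rewrite /cis !reimE ?mul0r ?addr0 ?subr0.
  by rewrite divfK // gt_eqF.
by rewrite hs; field; rewrite !gt_eqF.
Qed.

(** * Lifted half-turns *)

Lemma sqmod_cis (R : realType) (t : R) : sqmod (cis t) = 1.
Proof. by rewrite /sqmod /cis /= cos2Dsin2. Qed.

Lemma sqmodN (R : realType) (z : R[i]) : sqmod (- z) = sqmod z.
Proof. by rewrite /sqmod !reimE; ring. Qed.

Lemma sqmodJ (R : realType) (z : R[i]) : sqmod z^*%C = sqmod z.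
Proof. by rewrite /sqmod !reimE; ring. Qed.

Lemma re1D_gt0 (R : realType) (z : R[i]) : sqmod z < 1 -> 0 < re (1 + z).
Proof.
rewrite /sqmod !reimE => h.
have := sqr_ge0 (im z); move: (re z) (im z) h => x y h h2; nra.
Qed.

Lemma re1Dcis_gt0 (R : realType) (z : R[i]) (t : R) :
  disk z -> 0 < re (1 + z * cis t).
Proof. by move=> /diskE h; apply: re1D_gt0; rewrite sqmodM sqmod_cis mulr1. Qed.

(* Lift to R of the action of w |-> w + v w^* on rays; doubling the angles turns
   this action into the boundary action of mobius (- v). *)
Definition shift (R : realType) (v : R[i]) (t : R) : R :=
  t + argr (1 + v * cis (- (t + t))).

Lemma cisJ2 (R : realType) (t : R) : (cis t)^*%C = cis t * cis (- (t + t)).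
Proof. by rewrite -cisN -cisD; congr cis; ring. Qed.

Lemma shift_onray (R : realType) (v : R[i]) (t : R) (w : R[i]) :
  disk v -> onray t w -> onray (shift v t) (w + v * w^*%C).
Proof.
move=> dv [r r0 ->].
have -> : r%:C * cis t + v * (r%:C * cis t)^*%C
        = r%:C * (cis t * (1 + v * cis (- (t + t)))).
  have -> : (r%:C * cis t)^*%C = r%:C * (cis t)^*%C by cring.
  by rewrite cisJ2; ring.
apply: onrayZ => //; apply: onrayM; first exact: onray_cis.
exact/onray_argr/re1Dcis_gt0.
Qed.

Lemma shift_bounds (R : realType) (v : R[i]) (t : R) :
  t - pi / 2 < shift v t < t + pi / 2.
Proof.
have := argr_bounds (1 + v * cis (- (t + t))).
by rewrite /shift => /andP[h1 h2]; apply/andP; split; lra.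
Qed.

Lemma cis2pi (R : realType) (t : R) : cis (t - pi *+ 2) = cis t.
Proof. by rewrite -[in RHS](subrK (pi *+ 2) t) /cis sinD2pi cosD2pi. Qed.

Lemma shiftDpi (R : realType) (v : R[i]) (t : R) : shift v (t + pi) = shift v t + pi.
Proof.
rewrite /shift (_ : - _ = - (t + t) - pi *+ 2); last by rewrite mulr2n; ring.
by rewrite cis2pi; ring.
Qed.

Lemma sin_gt0_gt0 (R : realType) (t : R) : - pi < t -> 0 < sin t -> 0 < t.
Proof.
move=> h1 h2; rewrite ltNge; apply/negP; rewrite le_eqVlt => /predU1P[h|h].
  by rewrite h sin0 ltxx in h2.
by have := @sin_lt0_pi R t; rewrite h1 h => /(_ isT); lra.
Qed.

Lemma sin_ge0_ge0 (R : realType) (t : R) : - pi < t -> 0 <= sin t -> 0 <= t.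
Proof.
move=> h1 h2; rewrite leNgt; apply/negP => h.
by have := @sin_lt0_pi R t; rewrite h1 h => /(_ isT); lra.
Qed.

(** The real-linear map w + v w^* has determinant 1 - |v|^2 > 0, so it preserves the orientation of
    two vectors less than [pi] apart; for larger gaps [shift_bounds] suffices. *)
Lemma shift_homo (R : realType) (v : R[i]) : disk v -> {homo shift v : s t / s <= t}.
Proof.
move=> dv s t; rewrite le_eqVlt => /predU1P[->//|st].
have /andP[s1 s2] := shift_bounds v s; have /andP[t1 t2] := shift_bounds v t.
have [h|h] := leP pi (t - s); first lra.
rewrite -subr_ge0; apply/ltW/sin_gt0_gt0; first lra.
have [r r0] := onray_im (onrayM (shift_onray dv (onray_cis t))
                    (onrayJ (shift_onray dv (onray_cis s)))).
have -> : im ((cis t + v * (cis t)^*%C) * (cis s + v * (cis s)^*%C)^*%C)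
        = (1 - sqmod v) * sin (t - s).
  by rewrite sinB /cis /sqmod !reimE; ring.
rewrite -(pmulr_rgt0 _ r0) => <-.
apply: mulr_gt0; first by rewrite subr_gt0; apply/diskE.
by apply: sin_gt0_pi; apply/andP; split; lra.
Qed.

Lemma shiftNK (R : realType) (v : R[i]) : disk v -> cancel (shift (- v)) (shift v).
Proof.
move=> dv t; have dnv := diskN dv.
have h := shift_onray dv (shift_onray dnv (onray_cis t)).
have /andP[s1 s2] := shift_bounds (- v) t.
have /andP[t1 t2] := shift_bounds v (shift (- v) t).
apply: (onray_inj h).
  have -> : cis t + - v * (cis t)^*%C + v * (cis t + - v * (cis t)^*%C)^*%C
          = (1 - sqmod v)%:C * cis t.
    by rewrite /sqmod /cis; cring.
  by apply: onrayZ; [rewrite subr_gt0; apply/diskE | apply: onray_cis].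
by rewrite mulr2n; have p0 := @pi_gt0 R; apply/andP; split; lra.
Qed.

(** A quarter turn conjugates w + v w^* into w - v w^*. *)
Lemma shift_pihalf (R : realType) (v : R[i]) (t : R) :
  shift (- v) t = shift v (t - pi / 2) + pi / 2.
Proof.
rewrite /shift (_ : - (t - pi / 2 + (t - pi / 2)) = - (t + t) + pi); last by field.
rewrite cisD (_ : cis pi = -1); first by rewrite mulrN1 mulrN mulNr; ring.
by rewrite /cis cospi sinpi; cring.
Qed.

(* Lift of the half-turn about the point of Klein coordinate - z. *)
Definition turn (R : realType) (z : R[i]) (t : R) : R := shift z t + pi / 2.

Lemma turn_onray (R : realType) (z : R[i]) (t : R) (w : R[i]) :
  disk z -> onray t w -> onray (turn z t) ('i%C * (w + z * w^*%C)).
Proof.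
move=> dz h; rewrite /turn addrC.
exact: onrayM (onray_pihalf R) (shift_onray dz h).
Qed.

Lemma turn_bounds (R : realType) (z : R[i]) (t : R) : t < turn z t < t + pi.
Proof.
by have /andP[h1 h2] := shift_bounds z t; rewrite /turn; apply/andP; split; lra.
Qed.

Lemma turnDpi (R : realType) (z : R[i]) (t : R) : turn z (t + pi) = turn z t + pi.
Proof. by rewrite /turn shiftDpi; ring. Qed.

Lemma turn_homo (R : realType) (z : R[i]) : disk z -> {homo turn z : s t / s <= t}.
Proof. by move=> dz s t st; rewrite lerD2r shift_homo. Qed.

(** The real-linear map i (w + z w^* ) squares to the negative scalar -(1 - |z|^2). *)
Lemma turnK (R : realType) (z : R[i]) (t : R) : disk z -> turn z (turn z t) = t + pi.
Proof.
move=> dz; have := shiftNK (diskN dz) t; rewrite opprK => h.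
by rewrite /turn -{1}(opprK z) shift_pihalf addrK h; field.
Qed.

Lemma turnN (R : realType) (z : R[i]) (t : R) :
  turn (- z) t = turn z (t - pi / 2) + pi / 2.
Proof. by rewrite /turn shift_pihalf. Qed.

(** The two equations hold when [- z] is the Klein coordinate of the midpoint of [v] and [v']. The
    half-turn about it carries [v] to [v'], so after the translation from 0 to [v] it becomes the
    translation from 0 to [v'] preceded by a rotation about 0. *)
Lemma turn_shift (R : realType) (z v v' : R[i]) (c t : R) :
  disk z -> disk v -> disk v' -> 0 < c ->
  v' * (1 + z^*%C * v) = - (v + z) -> 1 + z * v^*%C = c%:C * (1 - v^*%C * v') ->
  turn z (shift v t) = shift v' (t + (pi / 2 + argr (1 - v^*%C * v'))).
Proof.
move=> dz dv dv' c0 e1 e2; set a := argr _.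
have hv : 0 < re (1 - v^*%C * v').
  apply: re1D_gt0; rewrite sqmodN sqmodM sqmodJ.
  move/diskE: dv => dv; move/diskE: dv' => dv'.
  have := sqmod_ge0 v; have := sqmod_ge0 v'; nra.
have h1 := turn_onray dz (shift_onray dv (onray_cis t)).
have h2 := shift_onray dv' (onrayM (onray_cis t)
             (onrayM (onray_pihalf R) (onray_argr hv))).
apply: (onray_inj h1).
  rewrite (_ : 'i%C * _ = c%:C * (cis t * ('i%C * (1 - v^*%C * v')) +
            v' * (cis t * ('i%C * (1 - v^*%C * v')))^*%C)).
    exact: onrayZ.
  have e2' : 1 + z^*%C * v = c%:C * (1 - v^*%C * v')^*%C.
    have -> : 1 + z^*%C * v = (1 + z * v^*%C)^*%C by jring.
    by rewrite e2; jring.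
  transitivity ('i%C * ((1 + z * v^*%C) * cis t - (- (v + z)) * (cis t)^*%C)); first by jring.
  by rewrite -e1 e2 e2'; jring.
have /andP[s1 s2] := shift_bounds v t.
have /andP[t1 t2] := turn_bounds z (shift v t).
have /andP[u1 u2] := shift_bounds v' (t + (pi / 2 + a)).
have /andP[w1 w2] := argr_bounds (1 - v^*%C * v'); rewrite -/a in w1 w2.
by rewrite mulr2n; apply/andP; split; lra.
Qed.

(** * Products of lifted half-turns *)

Lemma normr_re_le (R : realType) (N : R) (k c : R[i]) :
  0 <= N -> sqmod c = 1 -> sqmod k <= N ^+ 2 -> 0 <= N + re (k * c).
Proof.
move=> N0 hc hk; have : sqmod (k * c) <= N ^+ 2 by rewrite sqmodM hc mulr1.
rewrite /sqmod => h; have := sqr_ge0 (im (k * c)); move: h.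
by move: (re _) (im _) => r i h1 h2; nra.
Qed.

(** Up to a positive factor, the sine of the difference of the two sides is N + re (k cis (- 2 t)),
    where N is the real part in the first hypothesis. The second hypothesis amounts to |k|^2 <= N^2,
    and a difference above [- pi] with nonnegative sine is nonnegative when below 0 is excluded by
    [sin_ge0_ge0]. *)
Lemma turn_le_turn2 (R : realType) (z1 z2 z' : R[i]) :
  disk z1 -> disk z2 -> disk z' ->
  0 <= re (1 - z2 * z1^*%C - (z2 - z1) * z'^*%C) ->
  (im (1 - z2 * z1^*%C + (z2 - z1) * z'^*%C)) ^+ 2
    <= (1 - sqmod z1) * (1 - sqmod z2) * (1 - sqmod z') ->
  forall t, turn z' t <= turn z2 (turn z1 t).
Proof.
move=> d1 d2 d' hN he t; rewrite -subr_ge0.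
have /andP[a1 a2] := turn_bounds z1 t.
have /andP[b1 b2] := turn_bounds z2 (turn z1 t).
have /andP[c1 c2] := turn_bounds z' t.
apply: sin_ge0_ge0; first lra.
have [r r0 hr] := onray_im (onrayM (turn_onray d2 (turn_onray d1 (onray_cis t)))
                    (onrayJ (turn_onray d' (onray_cis t)))).
rewrite -(pmulr_rge0 _ r0) -hr.
set al := 1 - z2 * z1^*%C in hN he; set k := al^*%C * z' - (z2 - z1).
have -> : ('i%C * ('i%C * (cis t + z1 * (cis t)^*%C) +
     z2 * ('i%C * (cis t + z1 * (cis t)^*%C))^*%C)) *
     ('i%C * (cis t + z' * (cis t)^*%C))^*%C =
  'i%C * ((sqmod (cis t))%:C * (al - (z2 - z1) * z'^*%C) +
     (al * z'^*%C * cis t ^+ 2 - (z2 - z1) * (cis t)^*%C ^+ 2)).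
  rewrite -mulcJ /al !conjE; have := sqr_i R; move: (cis t) ('i%C) => w i /eqP.
  rewrite expr2 -addr_eq0 addrC => /eqP ii.
  apply/eqP; rewrite -subr_eq0; apply/eqP.
  (* The two sides agree modulo i^2 = -1: their difference is a multiple of [1 + i * i]. *)
  transitivity (- (1 + i * i) * (i * (w^*%C + z'^*%C * w) * (w + z1 * w^*%C
    - z2 * (w^*%C + z1^*%C * w)))); last by rewrite ii oppr0 mul0r.
  by ring.
rewrite sqmod_cis mul1r.
have -> : im ('i%C * (al - (z2 - z1) * z'^*%C +
     (al * z'^*%C * cis t ^+ 2 - (z2 - z1) * (cis t)^*%C ^+ 2)))
   = re (al - (z2 - z1) * z'^*%C) + re (k * (cis t)^*%C ^+ 2).
  set A := al * _ * _; have imi (x : R[i]) : im ('i%C * x) = re x by rewrite !reimE; ring.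
  rewrite imi reD; congr (_ + _).
  rewrite reD -(reJ A) -reD; congr re.
  by rewrite /A /k !expr2; jring.
apply: normr_re_le => //.
  by rewrite expr2 sqmodM sqmodJ sqmod_cis mulr1.
have e12 : (1 - sqmod z1) * (1 - sqmod z2) = sqmod al - sqmod (z2 - z1).
  by rewrite /al /sqmod !(expr2, reimE); ring.
rewrite {}e12 in he.
rewrite -(lerD2r ((im (al + (z2 - z1) * z'^*%C)) ^+ 2)).
rewrite -lerBrDl; apply: (le_trans he); rewrite le_eqVlt; apply/orP; left; apply/eqP.
by rewrite /k /sqmod; move: (al) (z2 - z1) => al' de; rewrite !(expr2, reimE); ring.
Qed.

(** Two deficits [1 - cmod] are traded for one that is at least their sum, or equals 1. The witness
    is 0 when [a + b <= 1], and otherwise a multiple of a weighted mean [q] of [z1] and [z2]. *)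
Lemma exists_merge (R : realType) (z1 z2 : R[i]) : disk z1 -> disk z2 ->
  exists z', [/\ disk z', cmod z' <= Num.max 0 (cmod z1 + cmod z2 - 1) &
    forall t, turn z' t <= turn z2 (turn z1 t)].
Proof.
move=> d1 d2; set a := cmod z1; set b := cmod z2.
have a1 : a < 1 := d1.
have b1 : b < 1 := d2.
have a0 : 0 <= a by apply: cmod_ge0.
have b0 : 0 <= b by apply: cmod_ge0.
have sa : sqmod z1 = a ^+ 2 by rewrite sqmodE.
have sb : sqmod z2 = b ^+ 2 by rewrite sqmodE.
set p := re (z2 * z1^*%C); set P := im (z2 * z1^*%C).
have pP : p ^+ 2 + P ^+ 2 = a ^+ 2 * b ^+ 2.
  by rewrite -sa -sb -(sqmodJ z1) mulrC -sqmodM.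
have pab : p <= a * b.
  have : p ^+ 2 <= (a * b) ^+ 2 by rewrite exprMn -pP lerDl sqr_ge0.
  move=> h; apply: le_trans (ler_norm _) _; rewrite -(@ler_pXn2r _ 2) ?nnegrE ?mulr_ge0 //.
  by rewrite real_normK // num_real.
have [ab|ab] := leP (a + b) 1.
  exists 0; rewrite cmod0; split.
  - exact: disk0.
  - by rewrite le_max lexx.
  (* P^2 <= a^2 b^2 is enough, because [a + b <= 1] gives a^2 + b^2 <= 1. *)
  apply: turn_le_turn2 => //; first exact: disk0.
    by rewrite conjc0 mulr0 subr0 reD re1 reN -/p; nra.
  rewrite conjc0 mulr0 addr0 imD im1 imN -/P sa sb /sqmod /= expr0n addr0 subr0 mulr1.
  rewrite add0r sqrrN; nra.
set x := 1 - a; set y := 1 - b; set c := a + b - 1.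
have x0 : 0 < x by rewrite subr_gt0.
have y0 : 0 < y by rewrite subr_gt0.
have c0 : 0 < c by rewrite subr_gt0.
have xy0 : 0 < x + y by apply: addr_gt0.
have cE : Num.max 0 c = c by apply/max_idPr/ltW.
set q : R[i] := (x%:C * z1 + y%:C * z2) * ((x + y)^-1)%:C.
set Q := cmod q; have Q0 : 0 <= Q by apply: cmod_ge0.
(* q lies on the chord [z1, z2]; its weights give |q| - c <= 2 x y / (x + y),
   so scaling q into the disk of radius c leaves the triangle z', z1, z2 small. *)
have main s : 0 <= s <= 1 -> s * Q <= c ->
    (P * (1 - s)) ^+ 2 <= (1 - a ^+ 2) * (1 - b ^+ 2) * (1 - (s * Q) ^+ 2) ->
    exists z', [/\ disk z', cmod z' <= Num.max 0 c &
      forall t, turn z' t <= turn z2 (turn z1 t)].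
  move=> /andP[s0 s1] sQ hP.
  have cz : cmod (s%:C * q) = s * Q by rewrite cmodM cmod_real.
  have dz : disk (s%:C * q) by rewrite /disk /= cz; rewrite /c in sQ; lra.
  exists (s%:C * q); rewrite cE cz; split => //.
  apply: turn_le_turn2 => //.
    set N := re _.
    have NE : N = ((1 - s) * (x + y) * (1 - p) +
       s * (x * (1 + a ^+ 2 - p *+ 2) + y * (1 - b ^+ 2))) / (x + y).
      rewrite -sa -sb /N /q /p /sqmod !reimE.
      by field; rewrite gt_eqF.
    rewrite NE divr_ge0 ?(ltW xy0) // addr_ge0 // mulr_ge0 //.
    - by rewrite mulr_ge0 ?(ltW xy0) // subr_ge0.
    - by nra.
    apply: addr_ge0; apply: mulr_ge0; rewrite ?(ltW x0) ?(ltW y0) //.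
      by rewrite mulr2n; nra.
    by nra.
  have -> : im (1 - z2 * z1^*%C + (z2 - z1) * (s%:C * q)^*%C) = - (P * (1 - s)).
    rewrite /q /P !reimE.
    by field; rewrite gt_eqF.
  by rewrite sqrrN sa sb sqmodE cz.
(* At [s = 1] the left side of the condition vanishes, since [q] is on the chord; otherwise [q] is
   scaled to modulus exactly [c]. *)
have [Qc|Qc] := leP Q c.
  apply: (main 1); rewrite ?ler01 ?lexx ?mul1r // subrr mulr0 expr0n /=.
  by apply: mulr_ge0; [apply: mulr_ge0; nra | rewrite subr_ge0; rewrite /c in Qc; nra].
have Qp : 0 < Q := lt_trans c0 Qc.
have QE : c / Q * Q = c by rewrite divfK // gt_eqF.
apply: (main (c / Q)); rewrite ?QE //.
  by rewrite divr_ge0 ?(ltW c0) //= ler_pdivrMr // mul1r ltW.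
set D := sqmod (z2 - z1).
have Q2 : Q ^+ 2 = (x ^+ 2 * a ^+ 2 + y ^+ 2 * b ^+ 2 + x * y * p *+ 2) / (x + y) ^+ 2.
  rewrite -sqmodE -sa -sb /q /p /sqmod !reimE.
  by field; rewrite gt_eqF.
(* [P] is the cross product of [z1] and [z2], hence that of [q] and the chord [z2 - z1]. *)
have PD : P ^+ 2 <= Q ^+ 2 * D.
  have -> : P = im (q^*%C * (z2 - z1)).
    rewrite /P /q !reimE.
    by field; rewrite gt_eqF.
  by rewrite -sqmodE -(sqmodJ q) -sqmodM /sqmod lerDr sqr_ge0.
have DE : D = a ^+ 2 + b ^+ 2 - p *+ 2.
  by rewrite -sa -sb /D /p /sqmod !reimE; ring.
have Qub : Q - c <= 2 * x * y / (x + y).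
  have -> : 2 * x * y / (x + y) = (x * a + y * b) / (x + y) - c.
    by rewrite /x /y /c; field; rewrite -/x -/y gt_eqF.
  rewrite lerD2r -(@ler_pXn2r _ 2) ?nnegrE //; last first.
    by rewrite divr_ge0 ?(ltW xy0) // addr_ge0 // mulr_ge0 // ltW.
  rewrite Q2 expr_div_n ler_pM2r ?invr_gt0 ?exprn_gt0 //.
  rewrite -subr_ge0 (_ : _ - _ = 2 * (x * y) * (a * b - p)); last by ring.
  by rewrite mulr_ge0 ?subr_ge0 // mulr_ge0 // mulr_ge0 // ltW.
(* [c < Q] bounds [p] from below, hence the squared chord length [D] from above. *)
have Dub : x * y * D <= x * y * ((x + y) * (a + b + 2 * c)).
  have : c ^+ 2 * (x + y) ^+ 2 <= Q ^+ 2 * (x + y) ^+ 2.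
    by rewrite ler_pM2r ?exprn_gt0 // ler_pXn2r ?nnegrE // ltW.
  rewrite Q2 divfK ?expf_neq0 ?gt_eqF // => h.
  rewrite DE -subr_ge0; rewrite -subr_ge0 in h; apply: le_trans h _.
  by rewrite le_eqVlt; apply/orP; left; apply/eqP; rewrite /x /y /c; ring.
have {}Dub : D <= (x + y) * (a + b + 2 * c).
  by rewrite -(ler_pM2l (mulr_gt0 x0 y0)).
have e1 : (P * (1 - c / Q)) ^+ 2 <= D * (Q - c) ^+ 2.
  have -> : 1 - c / Q = (Q - c) / Q by field; rewrite gt_eqF.
  rewrite mulrA expr_div_n exprMn ler_pdivrMr ?exprn_gt0 //.
  rewrite [leRHS](_ : _ = Q ^+ 2 * D * (Q - c) ^+ 2); last by ring.
  by apply: ler_wpM2r; rewrite ?sqr_ge0.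
apply: (le_trans e1).
have e2 : (Q - c) ^+ 2 <= (2 * x * y / (x + y)) ^+ 2.
  by rewrite ler_pXn2r ?nnegrE // ?subr_ge0 ?(ltW Qc) // ?divr_ge0 ?mulr_ge0 // ltW.
have D0 : 0 <= D by apply: sqmod_ge0.
have k0 : 0 <= a + b + 2 * c by lra.
apply: (@le_trans _ _ ((x + y) * (a + b + 2 * c) * (2 * x * y / (x + y)) ^+ 2)).
  by apply: ler_pM => //; apply: sqr_ge0.
have -> : (x + y) * (a + b + 2 * c) * (2 * x * y / (x + y)) ^+ 2 =
    x * y * (a + b + 2 * c) * ((4 * x * y) / (x + y)).
  by field; rewrite gt_eqF.
(* By 4 x y <= (x + y)^2; what then remains is a + b + 2 c <= (1 + a) (1 + b) (1 + c), true as
   [c <= 1]. *)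
apply: (@le_trans _ _ (x * y * (a + b + 2 * c) * (x + y))).
  apply: ler_wpM2l; first by rewrite !mulr_ge0 // ltW.
  rewrite ler_pdivrMr // -subr_ge0 (_ : _ - _ = (x - y) ^+ 2); last by ring.
  exact: sqr_ge0.
have -> : (1 - a ^+ 2) * (1 - b ^+ 2) * (1 - c ^+ 2) =
    x * y * ((1 + a) * (1 + b) * (1 + c)) * (x + y).
  by rewrite /x /y /c; ring.
apply: ler_wpM2r; first exact: ltW.
apply: ler_wpM2l; first by rewrite mulr_ge0 // ltW.
have c1 : c <= 1 by rewrite /c; lra.
have h1 : 0 <= a * b by apply: mulr_ge0.
have h2 : 0 <= (a + b + a * b) * c by rewrite mulr_ge0 ?(ltW c0) // !addr_ge0.
rewrite (_ : (1 + a) * _ * _ = 1 + a + b + a * b + c + (a + b + a * b) * c); last by ring.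
lra.
Qed.

Lemma onray_exists (R : realType) (w : R[i]) : w != 0 -> exists t, onray t w.
Proof.
move=> w0; have [h|h|h] := ltgtP 0 (re w).
- by exists (argr w); apply: onray_argr.
- exists (argr (- w) + pi).
  rewrite [X in onray _ X](_ : w = - w * -1); last by ring.
  by apply: onrayM; [apply: onray_argr; rewrite reN oppr_gt0 | apply: onray_pi].
- have wE : w = (im w)%:C * 'i%C by apply: complexP; rewrite !reimE -?h; ring.
  have [h2|h2|h2] := ltgtP 0 (im w).
  + by exists (pi / 2); rewrite wE; apply: onrayZ => //; apply: onray_pihalf.
  + exists (pi / 2 + pi); rewrite wE.
    rewrite (_ : _ * _ = (- im w)%:C * ('i%C * -1)).
      apply: onrayZ; first by rewrite oppr_gt0.
      by apply: onrayM; [apply: onray_pihalf | apply: onray_pi].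
    by apply: complexP; rewrite !reimE; ring.
  + by move: w0; rewrite wE -h2 mul0r eqxx.
Qed.

(** Multiplicativity of determinants: i (w + z w^* ) has determinant 1 - |z|^2, and the product of
    two such maps is computed in [turnv2E]. *)
Lemma sqmod_pivot (R : realType) (z1 z2 : R[i]) :
  sqmod (1 - z2 * z1^*%C) = sqmod (z2 - z1) + (1 - sqmod z1) * (1 - sqmod z2).
Proof. by rewrite /sqmod !(expr2, reimE); ring. Qed.

Lemma re1B_gt0 (R : realType) (z1 z2 : R[i]) :
  disk z1 -> disk z2 -> 0 < re (1 - z2 * z1^*%C).
Proof.
move=> /diskE d1 /diskE d2; apply: re1D_gt0; rewrite sqmodN sqmodM sqmodJ.
have := sqmod_ge0 z1; have := sqmod_ge0 z2; nra.
Qed.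

(** With al = 1 - z2 z1^*, the product of the two linear maps is - al (w + b w^* ): a rotation after
    [shift b]. *)
Lemma turn2E (R : realType) (z1 z2 : R[i]) : disk z1 -> disk z2 ->
  exists2 b : R[i], sqmod b < 1 &
  forall t, turn z2 (turn z1 t)
    = t + (pi + argr (1 - z2 * z1^*%C) + argr (1 + b * cis (- (t + t)))).
Proof.
move=> d1 d2; set al := 1 - _; have al0 : 0 < re al := re1B_gt0 d1 d2.
have aln : al != 0 by apply: contraTneq al0 => ->; rewrite re0 ltxx.
have sal : 0 < sqmod al := sqmod_gt0 aln.
set b := - (z2 - z1) / al.
have balE : b * al = - (z2 - z1) by rewrite divfK.
have sb : sqmod b < 1.
  rewrite -(ltr_pM2r sal) mul1r -sqmodM balE sqmodN sqmod_pivot ltrDl.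
  by apply: mulr_gt0; rewrite subr_gt0; apply/diskE.
exists b => // t.
have h1 := turn_onray d2 (turn_onray d1 (onray_cis t)).
have hb : 0 < re (1 + b * cis (- (t + t))) by apply/re1Dcis_gt0/diskE.
have h2 := onrayM (onray_cis t) (onrayM (onrayM (onray_pi R) (onray_argr al0))
  (onray_argr hb)).
apply: (onray_inj h1).
  rewrite (_ : 'i%C * _ = cis t * (-1 * al * (1 + b * cis (- (t + t))))) //.
  rewrite [RHS](_ : _ = - (al * cis t + b * al * (cis t)^*%C)); last first.
    by rewrite cisJ2; ring.
  rewrite balE /al !conjE.
  have := sqr_i R; move: (cis t) ('i%C) => w i /eqP.
  rewrite expr2 -addr_eq0 addrC => /eqP ii.
  apply/eqP; rewrite -subr_eq0; apply/eqP.
  transitivity ((1 + i * i) * (w + z1 * w^*%C - z2 * (w^*%C + z1^*%C * w))).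
    by ring.
  by rewrite ii mul0r.
have /andP[s1 s2] := turn_bounds z1 t.
have /andP[t1 t2] := turn_bounds z2 (turn z1 t).
have /andP[u1 u2] := argr_bounds al.
have /andP[v1 v2] := argr_bounds (1 + b * cis (- (t + t))).
by rewrite mulr2n; apply/andP; split; lra.
Qed.

Lemma argr_le (R : realType) (x y : R[i]) : 0 < re x -> 0 < re y ->
  im (x * y^*%C) <= 0 -> argr x <= argr y.
Proof.
move=> x0 y0 h; rewrite -subr_ge0.
have [r r0 hr] := onray_im (onrayM (onray_argr x0) (onrayJ (onray_argr y0))).
have /andP[u1 u2] := argr_bounds x; have /andP[v1 v2] := argr_bounds y.
apply: sin_ge0_ge0; first lra.
by rewrite -(pmulr_rge0 _ r0) -opprB sinN mulrN oppr_ge0 -hr.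
Qed.

(* Both sides have mean zero over the circle, so neither dominates. *)
Lemma exists_argr_le (R : realType) (b c : R[i]) : sqmod b < 1 -> sqmod c < 1 ->
  exists t, argr (1 + c * cis (- (t + t))) <= argr (1 + b * cis (- (t + t))).
Proof.
move=> b1 c1; have [->|cb] := eqVneq c b; first by exists 0.
have [th [r r0 hr]] : exists th, onray th (c - b).
  by apply: onray_exists; rewrite subr_eq0.
exists ((th + pi / 2) / 2).
have -> : - ((th + pi / 2) / 2 + (th + pi / 2) / 2) = - th - pi / 2 by field.
set u := cis _.
have hu : sqmod u = 1 := sqmod_cis _.
have cbu : (c - b) * u = r%:C * - 'i%C.
  rewrite hr -mulrA -cisD addrA subrr sub0r cisN.
  by rewrite /cis cos_pihalf sin_pihalf; congr (_ * _); cring.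
apply: argr_le; try exact/re1Dcis_gt0/diskE.
have -> : im ((1 + c * u) * (1 + b * u)^*%C)
        = im ((c - b) * b^*%C) * sqmod u + im ((c - b) * u).
  by rewrite /sqmod !reimE; ring.
rewrite hu mulr1 cbu (_ : im (r%:C * _) = - r); last by rewrite !reimE; ring.
rewrite subr_le0; apply: le_trans (ler_norm _) _.
rewrite -(@ler_pXn2r _ 2) ?nnegrE ?(ltW r0) // real_normK ?num_real //.
apply: (@le_trans _ _ (sqmod ((c - b) * b^*%C))); first by rewrite /sqmod lerDr sqr_ge0.
rewrite sqmodM sqmodJ hr sqmodM sqmod_cis mulr1.
have -> : sqmod r%:C = r ^+ 2 by rewrite /sqmod /= expr0n addr0.
by rewrite ler_piMr ?sqr_ge0 // ltW.
Qed.

(** * Four or more half-turns *)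

Lemma turnBpi (R : realType) (z : R[i]) (t : R) : turn z (t - pi) = turn z t - pi.
Proof. by rewrite -[in RHS](subrK pi t) turnDpi addrK. Qed.

Definition turns (R : realType) (zs : seq R[i]) (t : R) : R :=
  foldl (fun s z => turn z s) t zs.

Lemma turns_homo (R : realType) (zs : seq R[i]) :
  {in zs, forall z, disk z} -> {homo turns zs : s t / s <= t}.
Proof.
elim: zs => [|z zs ih] d s t st //=.
apply: ih => [w wz|]; first by apply: d; rewrite inE wz orbT.
by apply: turn_homo => //; apply: d; rewrite inE eqxx.
Qed.

Lemma four_turns_pair (R : realType) (z1 z2 z3 z4 : R[i]) :
  disk z1 -> disk z2 -> disk z3 -> disk z4 ->
  (forall t, turns [:: z1; z2; z3; z4] t <= t + pi + pi / 2) ->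
  1 <= sqmod z1 * sqmod z2 + sqmod z3 * sqmod z4.
Proof.
move=> d1 d2 d3 d4 H.
have key t : turn z2 (turn z1 t) <= turn z3 (turn z4 (t - pi / 2)).
  have := turn_homo d3 (turn_homo d4 (H t)).
  rewrite /= turnK // turnDpi turnK //.
  rewrite (_ : t + pi + pi / 2 = t - pi / 2 + pi + pi); last by field.
  by rewrite !turnDpi !lerD2r.
have [b b1 hb] := turn2E d1 d2; have [c c1 hc] := turn2E d4 d3.
set al := 1 - z2 * z1^*%C in hb; set ga := 1 - z3 * z4^*%C in hc.
have [t ht] : exists t, argr (1 + (- c) * cis (- (t + t)))
                     <= argr (1 + b * cis (- (t + t))).
  by apply: exists_argr_le; rewrite ?sqmodN.
have al0 : 0 < re al := re1B_gt0 d1 d2; have ga0 : 0 < re ga := re1B_gt0 d4 d3.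
have h : pi / 2 <= argr ga - argr al.
  have := key t; rewrite hb hc.
  rewrite (_ : - (t - pi / 2 + (t - pi / 2)) = - (t + t) + pi); last by field.
  rewrite cisD (_ : cis pi = -1); last by rewrite /cis cospi sinpi; cring.
  by rewrite mulrN1 mulrN -mulNr; move: ht; lra.
have [r r0 hr] := onray_re (onrayM (onray_argr ga0) (onrayJ (onray_argr al0))).
have le0 : re (ga * al^*%C) <= 0.
  rewrite hr pmulr_rle0 // -(subrK (pi / 2) (_ - _)) cosDpihalf oppr_le0.
  have /andP[u1 u2] := argr_bounds ga; have /andP[v1 v2] := argr_bounds al.
  by apply: sin_ge0_pi; apply/andP; split; lra.
have <- : sqmod (al + ga - 1) + 1 - 2 * re (ga * al^*%C) =
          sqmod z1 * sqmod z2 + sqmod z3 * sqmod z4.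
  have -> : sqmod z1 * sqmod z2 = sqmod (1 - al).
    by rewrite /al opprB addrCA subrr addr0 sqmodM sqmodJ mulrC.
  have -> : sqmod z3 * sqmod z4 = sqmod (1 - ga).
    by rewrite /ga opprB addrCA subrr addr0 sqmodM sqmodJ.
  by rewrite /sqmod; move: (al) (ga) => x y; rewrite !reimE; ring.
by have := sqmod_ge0 (al + ga - 1); lra.
Qed.

(** Conjugation by [turn z1] moves the first factor to the end; carried past the quarter turn of the
    bound, [z1] becomes [- z1]. *)
Lemma four_turns_rot (R : realType) (z1 z2 z3 z4 : R[i]) :
  disk z1 -> disk z2 -> disk z3 -> disk z4 ->
  (forall t, turns [:: z1; z2; z3; z4] t <= t + pi + pi / 2) ->
  forall t, turns [:: z2; z3; z4; - z1] t <= t + pi + pi / 2.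
Proof.
move=> d1 d2 d3 d4 H t; rewrite /= turnN.
have e : turn z1 (turn z1 t - pi) = t by rewrite turnBpi turnK // addrK.
have := turn_homo d1 (lerD (H (turn z1 t - pi)) (lexx (- (pi / 2)))).
rewrite /= e [X in _ <= turn z1 X](_ : _ = turn z1 t); last by field.
by rewrite turnK //; lra.
Qed.

(** With a, b, c, d the four moduli, the two pair inequalities add up to (a^2 + c^2) (b^2 + d^2) >=
    2. For f = a + c - 1 and g = b + d - 1 the factors are below 1 + f^2 and 1 + g^2, whose product
    is at most 2 if f, g > 0 and f + g <= 1. *)
Lemma four_turns (R : realType) (z1 z2 z3 z4 : R[i]) :
  disk z1 -> disk z2 -> disk z3 -> disk z4 ->
  (forall t, turns [:: z1; z2; z3; z4] t <= t + pi + pi / 2) ->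
  3 < cmod z1 + cmod z2 + cmod z3 + cmod z4.
Proof.
move=> d1 d2 d3 d4 H.
have h1 := four_turns_pair d1 d2 d3 d4 H.
have h2 := four_turns_pair d2 d3 d4 (diskN d1) (four_turns_rot d1 d2 d3 d4 H).
rewrite sqmodN !sqmodE in h1 h2.
have := cmod_ge0 z1; have := cmod_ge0 z2; have := cmod_ge0 z3; have := cmod_ge0 z4.
move: d1 d2 d3 d4 h1 h2; rewrite /disk /=.
move: (cmod z1) (cmod z2) (cmod z3) (cmod z4) => a b c d.
move=> a1 b1 c1 d1 h1 h2 d0 c0 b0 a0.
have h3 : 2 <= (a ^+ 2 + c ^+ 2) * (b ^+ 2 + d ^+ 2) by move: h1 h2; lra.
set u := _ + _ in h3; set w := _ + _ in h3.
have uE : u = 1 + (a + c - 1) ^+ 2 - 2 * (1 - a) * (1 - c) by rewrite /u; ring.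
have wE : w = 1 + (b + d - 1) ^+ 2 - 2 * (1 - b) * (1 - d) by rewrite /w; ring.
have u0 : 0 <= u by rewrite addr_ge0 ?sqr_ge0.
have w0 : 0 <= w by rewrite addr_ge0 ?sqr_ge0.
have u2 : u < 2 by rewrite /u; nra.
have w2 : w < 2 by rewrite /w; nra.
have u1 : 1 < u by nra.
have w1 : 1 < w by nra.
have f0 : 0 < a + c - 1 by have : u <= (a + c) ^+ 2 by [rewrite /u; nra]; nra.
have g0 : 0 < b + d - 1 by have : w <= (b + d) ^+ 2 by [rewrite /w; nra]; nra.
have uf : u < 1 + (a + c - 1) ^+ 2.
  by rewrite uE gtrBl mulr_gt0 // ?mulr_gt0 // subr_gt0.
have wg : w < 1 + (b + d - 1) ^+ 2.
  by rewrite wE gtrBl mulr_gt0 // ?mulr_gt0 // subr_gt0.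
rewrite ltNge; apply/negP => hs.
have fg : (a + c - 1) + (b + d - 1) <= 1 by lra.
move: f0 g0 uf wg fg; move: (a + c - 1) (b + d - 1) => f g f0 g0 uf wg fg.
have h5 : u * w < (1 + f ^+ 2) * (1 + g ^+ 2) by apply: ltr_pM => //; lra.
have fg1 : f * g <= 1 by nra.
have : (1 + f ^+ 2) * (1 + g ^+ 2) <= 2.
  rewrite (_ : _ * _ = 1 + (f + g) ^+ 2 - f * g * (2 - f * g)); last by ring.
  have : 0 <= f * g * (2 - f * g) by rewrite mulr_ge0 ?(ltW (mulr_gt0 _ _)) //; lra.
  have : (f + g) ^+ 2 <= 1 by rewrite expr_le1 // addr_ge0 // ltW.
  lra.
lra.
Qed.

(** Induction from four half-turns: merging the first two only lowers the product, because the later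
    ones are monotone. *)
Lemma turns_deficit (R : realType) (n : nat) (zs : seq R[i]) :
  size zs = n.+4 -> {in zs, forall z, disk z} ->
  (forall t, turns zs t <= t + pi + pi / 2) ->
  \sum_(z <- zs) (1 - cmod z) < 1.
Proof.
elim: n zs => [|n ih] zs.
  case: zs => [//|z1 [//|z2 [//|z3 [//|z4 [|//]]]]] _ d H.
  rewrite !big_cons big_nil.
  have h := @four_turns R z1 z2 z3 z4.
  have := h (d _ _) (d _ _) (d _ _) (d _ _) H.
  by rewrite !inE !eqxx !orbT => /(_ isT isT isT isT); lra.
case: zs => [//|z1 [//|z2 zs]] [sz] d H.
have d1 : disk z1 by apply: d; rewrite inE eqxx.
have d2 : disk z2 by apply: d; rewrite !inE eqxx orbT.
have dz : {in zs, forall z, disk z} by move=> z hz; apply: d; rewrite !inE hz !orbT.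
have [z' [d' hz' hle]] := exists_merge d1 d2.
have : \sum_(z <- z' :: zs) (1 - cmod z) < 1.
  apply: ih; first by rewrite /= sz.
    by move=> z; rewrite inE => /predU1P[->|/dz].
  move=> t; apply: le_trans (H t); rewrite /=.
  exact: (turns_homo dz).
have S0 : 0 <= \sum_(z <- zs) (1 - cmod z).
  by rewrite big_seq; apply: sumr_ge0 => z /dz hz; rewrite subr_ge0; apply/ltW/hz.
(* A maximum equal to 0 would give [z'] the deficit 1 by itself. *)
by rewrite !big_cons; move: hz'; rewrite le_max => /orP[]; lra.
Qed.

(** * Half-turns about the midpoints of the sides *)

(* Klein coordinate of the hyperbolic midpoint of a and b. *)
Definition kmid (R : realType) (a b : R[i]) : R[i] :=
  (a * (1 - sqmod b)%:C + b * (1 - sqmod a)%:C) * ((1 - sqmod a * sqmod b)^-1)%:C.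

Lemma kmid_den (R : realType) (a b : R[i]) : disk a -> disk b ->
  0 < 1 - sqmod a * sqmod b.
Proof.
move=> /diskE da /diskE db; have := sqmod_ge0 a; have := sqmod_ge0 b; nra.
Qed.

Lemma kmid_eq (R : realType) (a b : R[i]) : disk a -> disk b ->
  kmid a b * (1 - a * a^*%C * (b * b^*%C)) = a * (1 - b * b^*%C) + b * (1 - a * a^*%C).
Proof.
move=> da db; have h := kmid_den da db.
have e : 1 - a * a^*%C * (b * b^*%C) = (1 - sqmod a * sqmod b)%:C.
  by rewrite !mulcJ rmorphB rmorphM rmorph1.
rewrite e /kmid -mulrA -rmorphM mulVf ?gt_eqF // mulr1.
by rewrite !mulcJ !rmorphB !rmorph1.
Qed.

Lemma disk_kmid (R : realType) (a b : R[i]) : disk a -> disk b -> disk (kmid a b).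
Proof.
move=> da db; have h := kmid_den da db; apply/diskE.
rewrite /kmid sqmodM; have -> (t : R) : sqmod t%:C = t ^+ 2.
  by rewrite /sqmod /= expr0n addr0.
rewrite exprVn ltr_pdivrMr ?exprn_gt0 // mul1r -subr_gt0.
have -> : (1 - sqmod a * sqmod b) ^+ 2 -
     sqmod (a * (1 - sqmod b)%:C + b * (1 - sqmod a)%:C) =
   (1 - sqmod a) * (1 - sqmod b) * sqmod (1 - b * a^*%C).
  rewrite /sqmod !reimE; move: (re a) (im a) (re b) (im b) => x y x' y'; ring.
have r0 := re1B_gt0 da db.
apply: mulr_gt0; first by apply: mulr_gt0; rewrite subr_gt0; apply/diskE.
by apply: sqmod_gt0; apply: contraTneq r0 => ->; rewrite re0 ltxx.
Qed.

(** The half-turn about the point of Klein coordinate k is a |-> (k - a) / (1 - k^* a), see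
    [point_reflection_klein]; the one about the midpoint exchanges [a] and [b]. *)
Lemma kmid_swap (R : realType) (a b : R[i]) : disk a -> disk b ->
  b * (1 - (kmid a b)^*%C * a) = kmid a b - a.
Proof.
move=> da db; have := kmid_eq da db; move: (kmid a b) => k h.
have n0 : 1 - a * a^*%C * (b * b^*%C) != 0.
  rewrite (_ : _ - _ = (1 - sqmod a * sqmod b)%:C).
    by apply/eqP => /ofRI /eqP; rewrite gt_eqF // kmid_den.
  by rewrite !mulcJ rmorphB rmorphM rmorph1.
apply: (mulIf n0).
have h2 : k^*%C * (1 - a * a^*%C * (b * b^*%C)) =
    a^*%C * (1 - b * b^*%C) + b^*%C * (1 - a * a^*%C).
  have := congr1 conjc h; rewrite !conjE => e.
  transitivity (k^*%C * (1 - a^*%C * a * (b^*%C * b))); first by ring.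
  by rewrite e; ring.
transitivity (b * (1 - a * a^*%C * (b * b^*%C)) -
   a * b * (k^*%C * (1 - a * a^*%C * (b * b^*%C)))); first by ring.
by rewrite h2 mulrBl h; ring.
Qed.

(** Together with [kmid_swap], this provides the two equations of [turn_shift]. *)
Lemma kmid_ray (R : realType) (a b : R[i]) : disk a -> disk b ->
  exists2 c : R, 0 < c & 1 - kmid a b * a^*%C = c%:C * (1 - a^*%C * b).
Proof.
move=> da db; have h := kmid_den da db.
exists ((1 - sqmod a) / (1 - sqmod a * sqmod b)).
  by apply: divr_gt0 => //; rewrite subr_gt0; apply/diskE.
have Dn : 1 - sqmod a * sqmod b != 0 by rewrite gt_eqF.
have DE : 1 - a * a^*%C * (b * b^*%C) = (1 - sqmod a * sqmod b)%:C.
  by rewrite !mulcJ rmorphB rmorphM rmorph1.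
have n0 : (1 - sqmod a * sqmod b)%:C != 0 :> R[i].
  by apply/eqP => /ofRI /eqP; rewrite (negPf Dn).
have e := kmid_eq da db; rewrite DE in e.
apply: (mulIf n0).
have cD : ((1 - sqmod a) / (1 - sqmod a * sqmod b))%:C *
    (1 - sqmod a * sqmod b)%:C = 1 - a * a^*%C :> R[i].
  by rewrite -rmorphM divfK // mulcJ rmorphB rmorph1.
rewrite [RHS]mulrAC cD.
rewrite mulrBl mul1r mulrAC e -DE; ring.
Qed.

(** The real-linear map whose action on rays is lifted by [turn z]; it retains the trace and the
    determinant. *)
Definition turnv (R : realType) (w z : R[i]) : R[i] := 'i%C * (w + z * w^*%C).

(** The sign matches [turn], which lifts the half-turn about the point of Klein coordinate [- z]. *)
Definition mids (R : realType) (u : nat -> R[i]) (n : nat) : seq R[i] :=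
  [seq - kmid (u i) (u i.+1) | i <- iota 0 n].

(** The rotation collected along the path by [turn_shift]. For a counterclockwise path each term is
    half the angle sum of the triangle 0, [u i], [u i.+1], see [triangle_angles]. *)
Definition turning (R : realType) (u : nat -> R[i]) (n : nat) : R :=
  \sum_(i < n) (pi / 2 + argr (1 - (u i)^*%C * u i.+1)).

Lemma midsS (R : realType) (u : nat -> R[i]) n :
  mids u n.+1 = rcons (mids u n) (- kmid (u n) (u n.+1)).
Proof. by rewrite /mids -[in iota 0 _]addn1 iotaD map_cat /= cats1 add0n. Qed.

Lemma size_mids (R : realType) (u : nat -> R[i]) n : size (mids u n) = n.
Proof. by rewrite size_map size_iota. Qed.

Lemma disk_mids (R : realType) (u : nat -> R[i]) n :
  (forall i, disk (u i)) -> {in mids u n, forall z, disk z}.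
Proof. by move=> hd z /mapP[i _ ->]; apply/diskN/disk_kmid. Qed.

(** Each half-turn carries [u i] to [u i.+1], so the translations telescope. *)
Lemma turns_mids (R : realType) (u : nat -> R[i]) n t : (forall i, disk (u i)) ->
  turns (mids u n) (shift (u 0) t) = shift (u n) (t + turning u n).
Proof.
move=> hd; elim: n => [|n ih]; first by rewrite /turning big_ord0 addr0.
rewrite midsS /turns foldl_rcons -/(turns _ _) ih /turning big_ord_recr /= addrA.
have [c c0 hc] := kmid_ray (hd n) (hd n.+1).
apply: (@turn_shift _ _ _ _ c) => //; first exact/diskN/disk_kmid.
  by rewrite cjN mulNr kmid_swap // opprB addrC.
by rewrite mulNr.
Qed.

Lemma turnv_mids (R : realType) (u : nat -> R[i]) n : (forall i, disk (u i)) ->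
  exists2 mu : R[i], onray (turning u n) mu &
  forall w, foldl (@turnv R) (w + u 0 * w^*%C) (mids u n)
    = mu * w + u n * (mu * w)^*%C.
Proof.
move=> hd; elim: n => [|n [mu hmu ih]].
  exists 1 => [|w]; last by rewrite mul1r.
  by rewrite /turning big_ord0; exists 1; rewrite ?ltr01 // /cis cos0 sin0; cring.
have [c c0 hc] := kmid_ray (hd n) (hd n.+1).
have sw := kmid_swap (hd n) (hd n.+1).
set k := kmid _ _ in hc sw.
have a0 : 0 < re (1 - (u n)^*%C * u n.+1) by rewrite mulrC; apply: re1B_gt0.
exists (mu * ('i%C * (1 - k * (u n)^*%C))) => [|w].
  rewrite /turning big_ord_recr /=; apply: onrayM => //.
  apply: onrayM; first exact: onray_pihalf.
  by rewrite hc; apply: onrayZ => //; apply: onray_argr.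
rewrite midsS foldl_rcons ih /turnv -/k.
transitivity ('i%C * ((1 - k * (u n)^*%C) * (mu * w) - (k - u n) * (mu * w)^*%C)).
  by jring.
by rewrite -sw; jring.
Qed.

(** Since w - v w^* is w + v w^* conjugated by multiplication by i, the hypothesis makes - i (p w +
    q w^* ) conjugate to multiplication by - i mu. The conclusions compare half the traces, and the
    determinants. *)
Lemma half_turns_trace (R : realType) (p q v mu : R[i]) : disk v ->
  (forall w, p * (w + v * w^*%C) + q * (w + v * w^*%C)^*%C
    = mu * w + - v * (mu * w)^*%C) ->
  im p = im mu /\ sqmod p - sqmod q = sqmod mu.
Proof.
move=> /diskE dv H.
have h1 := H 1; have h2 := H 'i%C.
rewrite conjc1 !mulr1 in h1; rewrite !conjE in h1 h2; rewrite opprK in h2.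
have e1 : p + q * v^*%C = mu.
  have two : (2 : R[i]) != 0 by rewrite pnatr_eq0.
  apply: (mulIf two).
  have ii := sqr_i R; rewrite expr2 in ii.
  transitivity ((p * (1 + v) + q * (1 + v^*%C)) -
    'i%C * (p * ('i%C + v * - 'i%C) + q * (- 'i%C + v^*%C * 'i%C))).
    transitivity ((p * (1 + v) + q * (1 + v^*%C)) -
      ('i%C * 'i%C) * (p * (1 - v) - q * (1 - v^*%C))); last by ring.
    by rewrite ii; ring.
  rewrite h1 h2.
  transitivity (mu + - v * mu^*%C - ('i%C * 'i%C) * (mu + v * mu^*%C)); first by ring.
  by rewrite ii; ring.
have e2 : p * v + q = - v * mu^*%C.
  have : p * (1 + v) + q * (1 + v^*%C) - (p + q * v^*%C) = - v * mu^*%C.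
    by rewrite h1 e1; ring.
  by move=> <-; ring.
have V0 : 0 < 1 - sqmod v by rewrite subr_gt0.
have hp : (1 - sqmod v)%:C * p = mu + (sqmod v)%:C * mu^*%C.
  have -> : (1 - sqmod v)%:C * p = (p + q * v^*%C) - v^*%C * (p * v + q).
    by rewrite rmorphB rmorph1 /= -mulcJ; ring.
  by rewrite e1 e2 -mulcJ; ring.
have hq : (1 - sqmod v)%:C * q = - v * (mu + mu^*%C).
  have -> : (1 - sqmod v)%:C * q = (p * v + q) - v * (p + q * v^*%C).
    by rewrite rmorphB rmorph1 /= -mulcJ; ring.
  by rewrite e1 e2; ring.
split.
  apply: (mulfI (lt0r_neq0 V0)).
  have := congr1 (@complex.Im R) hp; rewrite !reimE !mul0r ?addr0 => ->.
  by ring.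
apply: (mulfI (expf_neq0 2 (lt0r_neq0 V0))).
have sC (t : R) (x : R[i]) : t ^+ 2 * sqmod x = sqmod (t%:C * x).
  by rewrite sqmodM; congr (_ * _); rewrite /sqmod /= expr0n addr0.
rewrite mulrBr !sC hp hq /sqmod !reimE.
by move: (re mu) (im mu) (re v) (im v) => x y x' y'; ring.
Qed.

Lemma turnv2E (R : realType) (y z1 z2 : R[i]) : turnv (turnv y z1) z2 =
  - (1 - z2 * z1^*%C) * y + (z2 - z1) * y^*%C.
Proof.
have := sqr_i R; rewrite /turnv !conjE; move: 'i%C => i ii.
transitivity (i ^+ 2 * (y + z1 * y^*%C) - i ^+ 2 * (z2 * (y^*%C + z1^*%C * y))).
  by ring.
by rewrite ii; ring.
Qed.

Lemma turnv3E (R : realType) (y z1 z2 z3 : R[i]) :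
  turnv (turnv (turnv y z1) z2) z3 =
  - 'i%C * ((1 - z2 * z1^*%C) - z3 * (z2 - z1)^*%C) * y
  + 'i%C * ((z2 - z1) - z3 * (1 - z2 * z1^*%C)^*%C) * y^*%C.
Proof. by rewrite turnv2E /turnv; jring. Qed.

(** * The inequality for a symmetric sequence of vertices *)

Lemma cos_pi3 (R : realType) : cos (pi / 3) = 2^-1 :> R.
Proof.
set x := pi / 3; have p0 := @pi_gt0 R.
have c0 : 0 < cos x by rewrite cos_gt0_pihalf // /x; apply/andP; split; lra.
have : cos (x + (x + x)) = -1.
  by rewrite (_ : _ + _ = pi) ?cospi // /x; field.
rewrite cosD cosD sinD => h.
have h2 : cos x ^+ 2 + sin x ^+ 2 = 1 := cos2Dsin2 x.
(* cos (3 x) = -1 is this equation in cos x, whose only positive root is 1/2. *)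
have : (cos x + 1) * (2 * cos x - 1) ^+ 2 = 0.
  move: (cos x) (sin x) h h2 => c s h h2.
  transitivity (c * (c * c - s * s) - s * (s * c + c * s) + 1
     + 3 * c * (c ^+ 2 + s ^+ 2 - 1)); first by ring.
  by rewrite h h2; ring.
move/eqP; rewrite mulf_eq0 expf_eq0 /= => /orP[/eqP h3|/eqP h3]; lra.
Qed.

(** If a + b <= 1, then a <= 1 - b and b <= 1 - a give a b (1 + a) (1 + b) <= (1 - a^2) (1 - b^2) <=
    4 a^2 b^2. Dividing by a b leaves (1 + a) (1 + b) <= 4 a b <= 1, which is absurd. *)
Lemma cmod_add_gt1 (R : realType) (a b P c : R) :
  0 <= a < 1 -> 0 <= b < 1 -> 2^-1 <= c -> P ^+ 2 <= a ^+ 2 * b ^+ 2 ->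
  P ^+ 2 = (1 - a ^+ 2) * (1 - b ^+ 2) * c ^+ 2 -> 1 < a + b.
Proof.
move=> /andP[a0 a1] /andP[b0 b1] c2 hP hE; rewrite ltNge; apply/negP => ab.
have A0 : 0 < (1 - a ^+ 2) * (1 - b ^+ 2) by apply: mulr_gt0; nra.
have c4 : 4^-1 <= c ^+ 2 by nra.
have h : (1 - a ^+ 2) * (1 - b ^+ 2) <= 4 * (a ^+ 2 * b ^+ 2).
  have : (1 - a ^+ 2) * (1 - b ^+ 2) * 4^-1 <= (1 - a ^+ 2) * (1 - b ^+ 2) * c ^+ 2.
    by rewrite ler_pM2l.
  by rewrite -hE; lra.
have ab0 : 0 <= a * b by apply: mulr_ge0.
have h3 : a * b * ((1 + a) * (1 + b)) <= (1 - a ^+ 2) * (1 - b ^+ 2).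
  rewrite (_ : (1 - _) * _ = (1 - b) * (1 - a) * ((1 + a) * (1 + b))); last by ring.
  apply: ler_wpM2r; first by rewrite mulr_ge0 // addr_ge0.
  by apply: ler_pM => //; lra.
have h4 : a * b * ((1 + a) * (1 + b)) <= a * b * (4 * (a * b)).
  by apply: (le_trans h3); apply: (le_trans h); rewrite le_eqVlt; apply/orP; left; apply/eqP; ring.
have ab4 : 4 * (a * b) <= 1.
  have := sqr_ge0 (a - b); nra.
have [ab1|ab1] := eqVneq (a * b) 0.
  by move: h; rewrite -exprMn ab1 expr0n mulr0; lra.
have {}ab1 : 0 < a * b by rewrite lt_def ab1.
by move: h4; rewrite ler_pM2l //; nra.
Qed.

(** Hyperbolic triangles have angle sum below [pi]: the imaginary part of each 1 - u_i^* u_(i+1) is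
    negative, hence so is its [argr]. *)
Lemma turning_lt (R : realType) (u : nat -> R[i]) (n : nat) :
  (forall i, disk (u i)) -> (forall i, 0 < im ((u i)^*%C * u i.+1)) ->
  (0 < n)%N -> turning u n < n%:R * (pi / 2).
Proof.
move=> hd hp n0; rewrite mulr_natl -[n in ltRHS](card_ord n) -sumr_const.
have lt i : pi / 2 + argr (1 - (u i)^*%C * u i.+1) < pi / 2.
  rewrite gtrDl ltNge; apply/negP => h.
  have a0 : 0 < re (1 - (u i)^*%C * u i.+1) by rewrite mulrC; apply: re1B_gt0.
  have /andP[_ b] := argr_bounds (1 - (u i)^*%C * u i.+1).
  have [r r0 e] := onray_im (onray_argr a0).
  have : 0 <= im (1 - (u i)^*%C * u i.+1).
    rewrite e mulr_ge0 ?(ltW r0) // sin_ge0_pi // h /=.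
    by have := @pi_gt0 R; lra.
  by rewrite imD imN im1; have := hp i; lra.
case: n n0 => // n _; rewrite /turning big_ord_recl [ltRHS]big_ord_recl.
by apply: ltr_leD => //; apply: ler_sum => i _; apply/ltW.
Qed.

Lemma symmetric_deficit (R : realType) (u : nat -> R[i]) (m k : nat) :
  (1 < m)%N -> (0 < k)%N -> (forall i, disk (u i)) -> u m = - u 0 ->
  (forall i, 0 < im ((u i)^*%C * u i.+1)) ->
  turning u m = pi / 2 + pi / k%:R ->
  \sum_(z <- mids u m) (1 - cmod z) < 1.
Proof.
move=> m1 k0 hd hm hp ht; have p0 := @pi_gt0 R.
have k0' : 0 < k%:R :> R by rewrite ltr0n.
have pk : pi / k%:R <= pi :> R.
  by rewrite ler_pdivrMr // ler_peMr ?(ltW p0) // ler1n.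
have lt := turning_lt hd hp (ltnW m1); rewrite ht in lt.
(* Applied to the bound [lt], this forces [2 < k] if m = 2 and [1 < k] if m = 3. *)
have kN n : pi / k%:R < pi / n%:R :> R -> (n < k)%N.
  case: n => [|n]; first by [].
  by rewrite ltr_pM2l // ltf_pV2 ?posrE ?ltr0n // ltr_nat.
have [mu [r r0 hmu] hv] := turnv_mids m hd.
rewrite hm ht in hv hmu.
have imu : im mu = r * cos (pi / k%:R).
  by rewrite hmu addrC /cis sinDpihalf !reimE mul0r addr0.
have ck n : (0 < n)%N -> (n <= k)%N -> cos (pi / n%:R) <= cos (pi / k%:R) :> R.
  move=> n0 nk; rewrite leNgt; apply/negP.
  have n0' : 0 < n%:R :> R by rewrite ltr0n.
  have pn : pi / n%:R <= pi :> R.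
    by rewrite ler_pdivrMr // ler_peMr ?(ltW p0) // ler1n.
  rewrite ltr_cos ?in_itv /= ?pk ?pn ?divr_ge0 ?(ltW p0) ?(ltW k0') ?(ltW n0') //.
  by rewrite ltr_pM2l // ltf_pV2 ?posrE // ltr_nat ltnNge nk.
case: m => [|[|[|[|m]]]] // in m1 hm ht lt hv *.
- have d1 : {in mids u 2, forall z, disk z} := disk_mids hd; rewrite /mids /= in hv d1 *.
  set z1 := - kmid (u 0%N) _ in hv d1 *; set z2 := - kmid (u 1%N) _ in hv d1 *.
  have dz1 : disk z1 by apply: d1; rewrite inE eqxx.
  have dz2 : disk z2 by apply: d1; rewrite !inE eqxx orbT.
  rewrite !big_cons big_nil.
  (* Since [u m = - u 0], the telescoped identity [hv] is the hypothesis of [half_turns_trace] for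
     [v = u 0]. *)
  have [e1 e2] := half_turns_trace (hd 0%N) (fun w => etrans (esym (turnv2E _ _ _)) (hv w)).
  have k3 : (2 < k)%N by apply: kN; move: lt; lra.
  have c3 := ck 3%N isT k3; rewrite cos_pi3 in c3.
  suff : 1 < cmod z1 + cmod z2 by lra.
  apply: (@cmod_add_gt1 _ _ _ (im mu) _ _ _ c3).
  + by rewrite cmod_ge0.
  + by rewrite cmod_ge0.
  + rewrite -e1 -!sqmodE -(sqmodJ z1) [X in _ <= X]mulrC -sqmodM /sqmod.
    have -> : im (- (1 - z2 * z1^*%C)) = im (z2 * z1^*%C).
      by rewrite imN imD im1 imN add0r opprK.
    by rewrite lerDr sqr_ge0.
  + have -> : (1 - cmod z1 ^+ 2) * (1 - cmod z2 ^+ 2) = r ^+ 2.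
      rewrite -!sqmodE -[LHS](addKr (sqmod (z2 - z1))) -sqmod_pivot.
      rewrite -(sqmodN (1 - _)) addrC e2 hmu sqmodM sqmod_cis mulr1.
      by rewrite /sqmod /= expr0n addr0.
    by rewrite imu exprMn.
- have d1 : {in mids u 3, forall z, disk z} := disk_mids hd; rewrite /mids /= in hv d1 *.
  set z1 := - kmid (u 0%N) _ in hv d1 *; set z2 := - kmid (u 1%N) _ in hv d1 *.
  set z3 := - kmid (u 2%N) _ in hv d1 *.
  have dz1 : cmod z1 < 1 by apply: d1; rewrite inE eqxx.
  have dz2 : cmod z2 < 1 by apply: d1; rewrite !inE eqxx orbT.
  have dz3 : cmod z3 < 1 by apply: d1; rewrite !inE eqxx !orbT.
  rewrite !big_cons big_nil.
  have [e1 _] := half_turns_trace (hd 0%N)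
    (fun w => etrans (esym (turnv3E _ _ _ _)) (hv w)).
  have k2 : (1 < k)%N by apply: kN; move: lt; lra.
  have c2 := ck 2%N isT k2; rewrite cos_pihalf in c2.
  have : 0 <= im mu by rewrite imu mulr_ge0 // ltW.
  rewrite -e1 => h.
  (* Expanding this square and using [0 <= im mu] gives |z1|^2 + |z2|^2 + |z3|^2 >= 2. *)
  have : 0 <= sqmod (z1 - z2 + z3) by apply: sqmod_ge0.
  have -> : sqmod (z1 - z2 + z3) = sqmod z1 + sqmod z2 + sqmod z3 - 2
     - 2 * im (- 'i%C * (1 - z2 * z1^*%C - z3 * (z2 - z1)^*%C)).
    by rewrite /sqmod; move: (z1) (z2) (z3) => a b c; rewrite !reimE; ring.
  have sq (z : R[i]) : cmod z < 1 -> sqmod z <= cmod z.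
    by move=> z1'; rewrite sqmodE expr2 ler_piMl ?cmod_ge0 // ltW.
  have s1 := sq _ dz1; have s2 := sq _ dz2; have s3 := sq _ dz3.
  move=> h2.
  suff : 2 < cmod z1 + cmod z2 + cmod z3 by lra.
  (* Strictness: |z1|^2 < |z1| unless [z1] is 0, and then |z2|^2 + |z3|^2 < 2. *)
  have st (z : R[i]) : cmod z < 1 -> sqmod z < cmod z \/ cmod z = 0.
    move=> z1'; rewrite sqmodE; have [->|n0] := eqVneq (cmod z) 0; [by right|left].
    by rewrite expr2 gtr_pMl // lt_def n0 cmod_ge0.
  case: (st _ dz1) => h1; last lra.
  by lra.
- apply: (turns_deficit (size_mids u m.+4) (disk_mids hd)) => s.
  (* With s = [shift (u 0)] of some angle, the product ends in [shift (- u 0)], which [shift_pihalf]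
     turns back into [shift (u 0)] plus [pi / 2]; then pi / k <= pi applies. *)
  have sE := shiftNK (hd 0%N) s; rewrite -{1}sE turns_mids // hm ht.
  rewrite shift_pihalf -{2}sE -shiftDpi lerD2r; apply: shift_homo; first exact: hd.
  by lra.
Qed.

(** * Angles of a centrally symmetric polygon *)

(* The argument of z, only when 0 <= im z and z != 0. *)
Definition argu (R : realType) (z : R[i]) : R := acos (re z / cmod z).

Lemma argu_onray (R : realType) (z : R[i]) : 0 < im z ->
  onray (argu z) z /\ 0 < argu z < pi.
Proof.
move=> z0; have zn : z != 0 by apply: contraTneq z0 => ->; rewrite im0 ltxx.
have s0 := sqmod_gt0 zn; have sE := sqmodE z.
have c0 : 0 < cmod z by rewrite lt_def cmod_ge0 andbT -(@sqrf_eq0 _ (cmod z)) -sE gt_eqF.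
have lt : (re z / cmod z) ^+ 2 < 1.
  rewrite expr_div_n -sE ltr_pdivrMr // mul1r /sqmod ltrDl exprn_gt0 //.
have /andP[l1 l2] : -1 < re z / cmod z < 1.
  by rewrite -ltr_norml -(@ltr_pXn2r _ 2) ?nnegrE // real_normK ?num_real // expr1n.
have b : -1 <= re z / cmod z <= 1 by rewrite !ltW.
split; last by rewrite acos_gt0 ?acos_ltpi // ?l1 ?l2 ?ltW.
exists (cmod z) => //; rewrite /argu /cis acosK ?in_itv //= sin_acos //.
have -> : 1 - (re z / cmod z) ^+ 2 = (im z / cmod z) ^+ 2.
  rewrite !expr_div_n -sE; apply: (mulIf (lt0r_neq0 s0)).
  by rewrite mulrBl !divfK ?gt_eqF // mul1r /sqmod addrAC subrr add0r.
rewrite sqrtr_sqr ger0_norm; last by rewrite divr_ge0 // ltW.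
by apply: complexP; rewrite !reimE mul0r ?addr0 ?subr0 mulrC divfK ?gt_eqF.
Qed.

Lemma hangleE (R : realType) (a p b : R[i]) :
  hangle a p b = argu (mobius p a * (mobius p b)^*%C).
Proof. by rewrite /hangle /argu cmodM cmodJ. Qed.

Lemma one_sub_neq0 (R : realType) (a z : R[i]) : disk a -> disk z ->
  1 - a^*%C * z != 0.
Proof. by move=> da dz; rewrite -mulNr; apply: disk_den_neq0 => //; apply/diskN/diskJ. Qed.

Lemma mobius_sqmod (R : realType) (a z : R[i]) : disk a -> disk z ->
  mobius a z = ((sqmod (1 - a^*%C * z))^-1)%:C * ((z - a) * (1 - a^*%C * z)^*%C).
Proof.
move=> da dz; have n := one_sub_neq0 da dz; have s0 := lt0r_neq0 (sqmod_gt0 n).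
rewrite /mobius; move: (1 - _) n s0 => d n s0; apply: (mulIf n).
rewrite divfK //; transitivity ((sqmod d)^-1%:C * (d * d^*%C) * (z - a)).
  by rewrite mulcJ -rmorphM mulVf // mul1r.
by ring.
Qed.

(** Only the ray matters for signs and angles, and this form is polynomial. *)
Lemma mobius_onray (R : realType) (a z : R[i]) : disk a -> disk z ->
  exists2 c : R, 0 < c & mobius a z = c%:C * ((z - a) * (1 - a * z^*%C)).
Proof.
move=> da dz; have s0 := sqmod_gt0 (one_sub_neq0 da dz).
exists (sqmod (1 - a^*%C * z))^-1; first by rewrite invr_gt0.
by rewrite mobius_sqmod // !conjE.
Qed.

(* For u, w seen counterclockwise from 0, the angles of the triangle 0 u w at u and at w. *)
Definition baseL (R : realType) (u w : R[i]) : R := argu (- u * (mobius u w)^*%C).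
Definition baseR (R : realType) (u w : R[i]) : R := argu (mobius w u * (- w)^*%C).

Lemma sqmod_lt1 (R : realType) (z : R[i]) : disk z -> sqmod z < 1.
Proof. by move/diskE. Qed.

Lemma baseL_im (R : realType) (u w : R[i]) : disk u -> disk w ->
  0 < im (u^*%C * w) -> 0 < im (- u * (mobius u w)^*%C).
Proof.
move=> du dw h; have [c c0 ->] := mobius_onray du dw.
rewrite (_ : im _ = c * ((1 - sqmod u) * im (u^*%C * w))).
  by rewrite !mulr_gt0 // subr_gt0 sqmod_lt1.
by rewrite /sqmod !reimE; ring.
Qed.

Lemma baseR_im (R : realType) (u w : R[i]) : disk u -> disk w ->
  0 < im (u^*%C * w) -> 0 < im (mobius w u * (- w)^*%C).
Proof.
move=> du dw h; have [c c0 ->] := mobius_onray dw du.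
rewrite (_ : im _ = c * ((1 - sqmod w) * im (u^*%C * w))).
  by rewrite !mulr_gt0 // subr_gt0 sqmod_lt1.
by rewrite /sqmod !reimE; ring.
Qed.

(** The three numbers whose arguments are the angles multiply to a positive multiple of -(1 - u^*
    w)^2, which gives the sum modulo 2 pi. *)
Lemma triangle_angles (R : realType) (u w : R[i]) : disk u -> disk w ->
  0 < im (u^*%C * w) ->
  argu (u^*%C * w) + baseL u w + baseR u w
    = (pi / 2 + argr (1 - u^*%C * w)) *+ 2.
Proof.
move=> du dw h.
have [ha /andP[a1 a2]] := argu_onray h.
have [hl /andP[l1 l2]] := argu_onray (baseL_im du dw h).
have [hr /andP[r1 r2]] := argu_onray (baseR_im du dw h).
rewrite -/(baseL u w) -/(baseR u w) in hl hr l1 l2 r1 r2 *.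
have d0 : 0 < re (1 - u^*%C * w) by rewrite mulrC; apply: re1B_gt0.
have /andP[b1 b2] := argr_bounds (1 - u^*%C * w).
have hd := onray_argr d0.
have [c c0 e1] := mobius_onray du dw; have [c' c0' e2] := mobius_onray dw du.
(* Two angles add up to less than [pi], so all three stay below 2 pi in total, as [onray_inj]
   requires. *)
have al : argu (u^*%C * w) + baseL u w < pi.
  rewrite ltNge; apply/negP => ge.
  have [r r0 e] := onray_im (onrayM ha hl).
  have : 0 < im (u^*%C * w * (- u * (mobius u w)^*%C)).
    rewrite e1 (_ : im _ = c * (sqmod u * im (u^*%C * w) *
         (1 + sqmod w - 2 * re (u^*%C * w)))); last first.
      set s := u^*%C * w; have ss : sqmod s = sqmod u * sqmod w.
        by rewrite sqmodM sqmodJ.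
      transitivity (im (c%:C * (((sqmod u)%:C * s - (sqmod s)%:C) * (1 - s)))).
        by congr im; rewrite -!mulcJ /s !conjE; ring.
      by rewrite (mulrDr (sqmod u * _)) !reimE ss; ring.
    have su : 0 < sqmod u.
      by apply: sqmod_gt0; apply: contraTneq h => ->; rewrite conjc0 mul0r im0 ltxx.
    apply: mulr_gt0 => //; apply: mulr_gt0; first exact: mulr_gt0.
    have := sqmod_lt1 du; have := sqmod_lt1 dw; have := sqmod_ge0 w.
    have : re (u^*%C * w) ^+ 2 <= sqmod u * sqmod w.
      by rewrite -(sqmodJ u) -sqmodM /sqmod lerDl sqr_ge0.
    move: (re _) (sqmod u) (sqmod w) su => p A B A0 hpp B0 B1 A1.
    have : p ^+ 2 <= B by apply: (le_trans hpp); rewrite ler_piMl // ltW.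
    move=> pB; have [p0|p0] := leP p 0; first by lra.
    have := sqr_ge0 (1 - B); nra.
  rewrite e pmulr_rgt0 //.
  have : sin (argu (u^*%C * w) + baseL u w - pi) >= 0.
    by rewrite sin_ge0_pi //; apply/andP; split; lra.
  have := sinDpi (argu (u^*%C * w) + baseL u w - pi); rewrite subrK => ->; lra.
apply: (onray_inj (onrayM (onrayM ha hl) hr)).
  have := onrayM (onray_pi R) (onrayM hd hd).
  have n := sqmod_gt0 (one_sub_neq0 du dw).
  have uw : 0 < sqmod (u^*%C * w).
    by apply: sqmod_gt0; apply: contraTneq h => ->; rewrite im0 ltxx.
  have uw' : 0 < sqmod (u - w).
    apply: sqmod_gt0; rewrite subr_eq0; apply: contraTneq h => ->.
    by rewrite mulrC mulcJ imC ltxx.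
  have pos : 0 < c * c' * (sqmod (u^*%C * w) * sqmod (u - w)) by rewrite !mulr_gt0.
  move=> /(onrayZ pos).
  rewrite (_ : pi + _ = (pi / 2 + argr (1 - u^*%C * w)) *+ 2); last first.
    by rewrite mulr2n; field.
  congr onray; rewrite e1 e2 !conjE !rmorphM /= -!mulcJ !conjE; ring.
have p0 := @pi_gt0 R; apply/andP; split; lra.
Qed.

(** The ray from [w] to 0 splits the angle: arguments add, without wrap-around because all three
    angles lie in (0, pi). *)
Lemma interior_split (R : realType) (u w t : R[i]) :
  disk u -> disk w -> disk t -> 0 < im (u^*%C * w) -> 0 < im (w^*%C * t) ->
  0 < hside w t u -> hangle u w t = baseR u w + baseL w t.
Proof.
move=> du dw dt h1 h2 hs; rewrite hangleE.
have [hg /andP[g1 g2]] := argu_onray hs.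
have [hl /andP[l1 l2]] := argu_onray (baseL_im dw dt h2).
have [hr /andP[r1 r2]] := argu_onray (baseR_im du dw h1).
rewrite -/(baseL w t) -/(baseR u w) in hl hr l1 l2 r1 r2 *.
have sw : 0 < sqmod w.
  by apply: sqmod_gt0; apply: contraTneq h1 => ->; rewrite mulr0 im0 ltxx.
apply: (onray_inj (onrayZ sw hg)).
  have := onrayM hr hl; congr onray.
  by rewrite -mulcJ !conjE; ring.
have p0 := @pi_gt0 R; apply/andP; split; lra.
Qed.

(** Sum [triangle_angles] and regroup the base angles by vertex; the index shift in [baseL]
    telescopes along the closed path. *)
Lemma polygon_turning (R : realType) (u : nat -> R[i]) (n : nat) :
  (forall i, disk (u i)) -> (forall i, 0 < im ((u i)^*%C * u i.+1)) ->
  (forall i, 0 < hside (u i.+1) (u i.+2) (u i)) ->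
  u n = u 0 -> u n.+1 = u 1 ->
  turning u n *+ 2 = \sum_(i < n) argu ((u i)^*%C * u i.+1)
    + \sum_(i < n) hangle (u i) (u i.+1) (u i.+2).
Proof.
move=> hd hp hs e0 e1; rewrite /turning -sumrMnl.
under eq_bigr do rewrite -triangle_angles //.
rewrite !big_split /= -addrA; congr (_ + _).
under [RHS]eq_bigr do rewrite interior_split //.
rewrite big_split /= addrC; congr (_ + _).
apply/esym/eqP; rewrite -subr_eq0 -sumrB.
rewrite -(big_mkord xpredT (fun i => baseL (u i.+1) (u i.+2) - baseL (u i) (u i.+1))).
by rewrite (telescope_sumr (fun i => baseL (u i) (u i.+1))) // e0 e1 subrr.
Qed.

(** In [winding], - k0 and - k1 are also vertices. Convexity puts - k0 left of the edge from kj to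
    kl, and kj, kl left of the edge from - k0 to - k1, so the former edge cannot pass the ray of -
    k0. Algebraically, the relation Q P = x Y - y X contradicts the signs. *)
Lemma cross_conflict (R : realType) (k0 k1 kj kl : R[i]) :
  0 < im (k0^*%C * k1) -> 0 < im (kj^*%C * kl) ->
  0 <= im (k0^*%C * kj) -> im (k0^*%C * kl) <= 0 ->
  0 < im (kj^*%C * kl) + im (kl^*%C * - k0) + im ((- k0)^*%C * kj) ->
  0 < im ((- k0)^*%C * - k1) + im ((- k1)^*%C * kj) + im (kj^*%C * - k0) ->
  0 < im ((- k0)^*%C * - k1) + im ((- k1)^*%C * kl) + im (kl^*%C * - k0) -> False.
Proof.
set Q := im (k0^*%C * k1); set P := im (kj^*%C * kl).
set x := im (k0^*%C * kj); set y := im (k0^*%C * kl).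
set X := im (k1^*%C * kj); set Y := im (k1^*%C * kl).
have -> : im (kl^*%C * - k0) = y by rewrite /y !reimE; ring.
have -> : im ((- k0)^*%C * kj) = - x by rewrite /x !reimE; ring.
have -> : im ((- k0)^*%C * - k1) = Q by rewrite /Q !reimE; ring.
have -> : im ((- k1)^*%C * kj) = - X by rewrite /X !reimE; ring.
have -> : im ((- k1)^*%C * kl) = - Y by rewrite /Y !reimE; ring.
have -> : im (kj^*%C * - k0) = x by rewrite /x !reimE; ring.
have id : - (Q * P) = y * X - x * Y.
  by rewrite /Q /P /x /y /X /Y !reimE; ring.
move: Q P x y X Y id => Q P x y X Y id Q0 P0 x0 y0 h1 h2 h3.
have e2 : y * (Q - X + x) <= 0 by rewrite mulr_le0_ge0 // ltW.
have e3 : 0 <= x * (Q - Y + y) by rewrite mulr_ge0 // ltW.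
have e4 : 0 < Q * (P + y - x) by apply: mulr_gt0.
lra.
Qed.

(* Half of the Klein coordinate, hence of modulus less than 1/2. *)
Definition hklein (R : realType) (a : R[i]) : R[i] := ((1 + sqmod a)^-1)%:C * a.

Lemma hkleinN (R : realType) (z : R[i]) : hklein (- z) = - hklein z.
Proof. by rewrite /hklein sqmodN mulrN. Qed.

Definition cross (R : realType) (a b : R[i]) : R := im (a^*%C * b).

(* Twice the signed area of the triangle a b z. *)
Definition orient (R : realType) (a b z : R[i]) : R :=
  cross a b + cross b z + cross z a.

Lemma cross_hklein (R : realType) (a b : R[i]) :
  cross (hklein a) (hklein b) = cross a b / ((1 + sqmod a) * (1 + sqmod b)).
Proof. by rewrite /cross /hklein invfM !reimE; ring. Qed.

Lemma oneD_sqmod (R : realType) (a : R[i]) : 0 < 1 + sqmod a.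
Proof. by rewrite ltr_pwDl // sqmod_ge0. Qed.

(** Geodesics are straight chords in the Klein model, so the side of a geodesic is the orientation
    of a Euclidean triangle. *)
Lemma hside_hklein (R : realType) (a b z : R[i]) : disk a -> disk b -> disk z ->
  exists2 c : R, 0 < c & hside a b z = c * orient (hklein a) (hklein b) (hklein z).
Proof.
move=> da db dz; have [c c0 e] := mobius_onray da dz.
have [d d0 f] := mobius_onray da db.
have pa := oneD_sqmod a; have pb := oneD_sqmod b; have pz := oneD_sqmod z.
exists (c * d * (1 - sqmod a) * ((1 + sqmod a) * (1 + sqmod b) * (1 + sqmod z))).
  by rewrite !mulr_gt0 // subr_gt0 sqmod_lt1.
have -> : hside a b z = c * d * (1 - sqmod a) * (cross a b * (1 + sqmod z)
   + cross b z * (1 + sqmod a) + cross z a * (1 + sqmod b)).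
  by rewrite /hside e f /cross /sqmod !reimE; ring.
rewrite -!mulrA; do 3 congr (_ * _); rewrite /orient !cross_hklein.
by field; rewrite !gt_eqF.
Qed.

(** The lifted argument [a j] of [u j] seen from [u 0] is [pi] modulo 2 pi at [j = m]. It suffices
    that it stays below [pi] before: [cross_conflict] forbids an earlier edge to pass the ray of - u
    0 = u m. *)
Lemma winding (R : realType) (u : nat -> R[i]) (m : nat) : (1 < m)%N ->
  (forall i, disk (u i)) -> (forall i, u (i + m)%N = - u i) ->
  (forall i, 0 < im ((u i)^*%C * u i.+1)) ->
  (forall i j, (i.+1 < 2 * m)%N -> (j < 2 * m)%N -> j != i -> j != i.+1 ->
     0 < hside (u i) (u i.+1) (u j)) ->
  \sum_(i < m) argu ((u i)^*%C * u i.+1) = pi.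
Proof.
move=> m1 hd hs hp hc; have p0 := @pi_gt0 R.
pose al i := argu ((u i)^*%C * u i.+1).
have al0 i : onray (al i) ((u i)^*%C * u i.+1) /\ 0 < al i < pi by apply: argu_onray.
pose a j := \sum_(i < j) al i.
have aS j : a j.+1 = a j + al j by rewrite /a big_ord_recr.
have a0 j : 0 <= a j.
  by apply: sumr_ge0 => i _; have [_ /andP[/ltW]] := al0 i.
have un i : 0 < sqmod (u i).
  apply: sqmod_gt0; have := hp i; apply: contraTneq => ->.
  by rewrite conjc0 mul0r im0 ltxx.
have ha j : onray (a j) ((u 0)^*%C * u j).
  elim: j => [|j ih].
    rewrite mulrC mulcJ /a big_ord0; exists (sqmod (u 0)) => //.
    by rewrite /cis cos0 sin0; cring.
  have [h _] := al0 j; have := onrayM ih h.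
  have un' : 0 < (sqmod (u j))^-1 by rewrite invr_gt0.
  move=> /(onrayZ un'); rewrite -aS; congr onray.
  transitivity ((sqmod (u j))^-1%:C * (u j * (u j)^*%C) * ((u 0)^*%C * u j.+1)); first by ring.
  by rewrite mulcJ -rmorphM mulVf ?mul1r // gt_eqF.
have hk i j : (i.+1 < 2 * m)%N -> (j < 2 * m)%N -> j != i -> j != i.+1 ->
    0 < orient (hklein (u i)) (hklein (u i.+1)) (hklein (u j)).
  move=> i1 j1 ji ji1; have [c c0 e] := hside_hklein (hd i) (hd i.+1) (hd j).
  by have := hc i j i1 j1 ji ji1; rewrite e pmulr_rgt0.
have lt j : (j < m)%N -> a j < pi.
  elim: j => [|j ih] jm; first by rewrite /a big_ord0.
  have ajpi := ih (ltnW jm); rewrite ltNge; apply/negP => ge.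
  have [_ /andP[al1 al2]] := al0 j.
  have j0 : (0 < j)%N.
    case: j ge {ih jm} ajpi al1 al2 => // ge _ _ al2.
    by move: ge; rewrite aS /a big_ord0 add0r; lra.
  have um : u m = - u 0 by have := hs 0; rewrite add0n.
  have um1 : u m.+1 = - u 1 by have := hs 1; rewrite add1n.
  have mm : (m < 2 * m)%N by rewrite ltn_Pmull // ltnW.
  have jm' : (j < m)%N := ltnW jm.
  have m1' : (m.+1 < 2 * m)%N by rewrite mul2n -addnn -addn1 ltn_add2l.
  have E1 := hk j m (ltn_trans jm mm) mm (negbT (gtn_eqF jm')) (negbT (gtn_eqF jm)).
  have E2 := hk m j m1' (ltn_trans jm' mm) (negbT (ltn_eqF jm'))
    (negbT (ltn_eqF (leqW jm'))).
  have E3 := hk m j.+1 m1' (ltn_trans jm mm) (negbT (ltn_eqF jm))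
    (negbT (ltn_eqF (leqW jm))).
  rewrite um um1 !hkleinN in E1 E2 E3.
  have sgn i : exists2 r, 0 < r & cross (hklein (u 0)) (hklein (u i)) = r * sin (a i).
    have [r r0 e] := onray_im (ha i).
    exists (r / ((1 + sqmod (u 0)) * (1 + sqmod (u i)))).
      by rewrite divr_gt0 // mulr_gt0 ?oneD_sqmod.
    by rewrite cross_hklein /cross e mulrAC.
  have pos i : 0 < cross (hklein (u i)) (hklein (u i.+1)).
    by rewrite cross_hklein divr_gt0 ?mulr_gt0 ?oneD_sqmod // hp.
  apply: (@cross_conflict _ (hklein (u 0)) (hklein (u 1)) (hklein (u j)) (hklein (u j.+1))) => //.
  - exact: (pos 0%N).
  - exact: (pos j).
  - have [r r0 e] := sgn j; rewrite -/(cross _ _) e mulr_ge0 ?(ltW r0) //.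
    by rewrite sin_ge0_pi // a0 ltW.
  - have [r r0 e] := sgn j.+1; rewrite -/(cross _ _) e pmulr_rle0 //.
    rewrite -[a _](subrK pi) sinDpi oppr_le0 sin_ge0_pi //.
    by rewrite subr_ge0 ge /= aS; lra.
have m0 : (0 < m)%N := ltnW m1.
have e := ha m; have um : u m = - u 0 by have := hs 0; rewrite add0n.
rewrite -[LHS]/(a m); apply: (onray_inj e).
  rewrite um (_ : _ * - u 0 = (sqmod (u 0))%:C * -1); last by rewrite -mulcJ; ring.
  by apply: onrayZ => //; apply: onray_pi.
have := lt m.-1; rewrite ltn_predL => /(_ m0) h.
have [_ /andP[al1 al2]] := al0 m.-1.
have := aS m.-1; rewrite prednK // => ->.
by have := a0 m.-1; rewrite mulr2n => ?; apply/andP; split; lra.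
Qed.

(** * Hyperbolic isometries and translation lengths *)

(** Both isometries take [x] to 0, so they differ by a rotation about 0; its factor cancels in the
    products defining [hside] and [hangle]. *)
Lemma mobius_phase (R : realType) (a x : R[i]) : disk a -> disk x ->
  exists2 e : R[i], sqmod e = 1 &
  forall y, disk y -> mobius (mobius a x) (mobius a y) = e * mobius x y.
Proof.
move=> da dx; have n1 := one_sub_neq0 da dx.
exists ((1 - a^*%C * x)^*%C / (1 - a^*%C * x)).
  have s0 := lt0r_neq0 (sqmod_gt0 n1).
  apply: (mulIf s0); rewrite -sqmodM divfK // sqmodJ mul1r //.
move=> y dy; have n2 := one_sub_neq0 da dy; have n3 := one_sub_neq0 dx da.
have n4 := one_sub_neq0 dx dy; have n5 := one_sub_neq0 da da.
rewrite /mobius !fmorph_div !rmorphB !rmorphM !rmorph1 /= conjcK.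
move: n1 n2 n3 n4 n5; move: (a^*%C) (x^*%C) => a' x' n1 n2 n3 n4 n5.
rewrite mulrC in n3; field; rewrite n1 n2 n3 n4 /=.
have -> : (1 - a * x') * (1 - a' * y) - (x' - a') * (y - a)
        = (1 - a' * a) * (1 - x' * y) by ring.
exact: mulf_neq0.
Qed.

Lemma hform_mobius (R : realType) (o p a b : R[i]) :
  disk o -> disk p -> disk a -> disk b ->
  mobius (mobius o p) (mobius o a) * (mobius (mobius o p) (mobius o b))^*%C
    = mobius p a * (mobius p b)^*%C.
Proof.
move=> d0 dp da db; have [e e1 he] := mobius_phase d0 dp; rewrite !he //.
transitivity ((e * e^*%C) * (mobius p a * (mobius p b)^*%C)).
  by rewrite cjM; ring.
by rewrite mulcJ e1 mul1r.
Qed.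

Lemma hside_mobius (R : realType) (o a b z : R[i]) :
  disk o -> disk a -> disk b -> disk z ->
  hside (mobius o a) (mobius o b) (mobius o z) = hside a b z.
Proof. by move=> *; rewrite /hside hform_mobius. Qed.

Lemma hangle_mobius (R : realType) (o a p b : R[i]) :
  disk o -> disk a -> disk p -> disk b ->
  hangle (mobius o a) (mobius o p) (mobius o b) = hangle a p b.
Proof. by move=> *; rewrite !hangleE hform_mobius. Qed.

Lemma mobiusK (R : realType) (a z : R[i]) : disk a -> disk z ->
  mobius a (mobius (- a) z) = z.
Proof. by move=> da dz; rewrite -{1}[a]opprK mobiusNK //; apply: diskN. Qed.

Lemma mobius_self (R : realType) (a : R[i]) : mobius a a = 0.
Proof. by rewrite /mobius subrr mul0r. Qed.

Lemma disk_point_reflection (R : realType) (p z : R[i]) :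
  disk p -> disk z -> disk (point_reflection p z).
Proof.
by move=> dp dz; apply: mobius_disk; [apply: diskN | apply/diskN/mobius_disk].
Qed.

Lemma mobius_point_reflection (R : realType) (a p z : R[i]) :
  disk a -> disk p -> disk z ->
  mobius a (point_reflection p z) = point_reflection (mobius a p) (mobius a z).
Proof.
move=> da dp dz; have [e _ he] := mobius_phase da dp.
have dr := disk_point_reflection dp dz.
have E : - mobius (mobius a p) (mobius a z)
       = mobius (mobius a p) (mobius a (point_reflection p z)).
  rewrite !he //; transitivity (e * - mobius p z); [by rewrite mulrN | congr (_ * _)].
  by rewrite mobiusK //; apply/diskN/mobius_disk.
by rewrite {2}/point_reflection E mobiusNK //; apply: mobius_disk.
Qed.

(** Passage from the Poincare to the Klein model: a point at distance d from 0 has modulus tanh (d /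
    2) in the former and tanh d in the latter. *)
Definition klein (R : realType) (p : R[i]) : R[i] := p * (2 / (1 + sqmod p))%:C.

Lemma klein_eq (R : realType) (p : R[i]) : klein p * (1 + p * p^*%C) = 2 * p.
Proof.
have -> : 1 + p * p^*%C = (1 + sqmod p)%:C by rewrite mulcJ; cring.
by rewrite -mulrA -rmorphM divfK ?gt_eqF ?oneD_sqmod // rmorph_nat mulrC.
Qed.

Lemma point_reflection_klein (R : realType) (p z : R[i]) : disk p -> disk z ->
  point_reflection p z * (1 - (klein p)^*%C * z) = klein p - z.
Proof.
move=> dp dz; have n1 := one_sub_neq0 dp dz; have dm := mobius_disk dp dz.
have n2 := one_sub_neq0 dp dm.
have e := klein_eq p; move: (klein p) e => k e.
have e' : k^*%C * (1 + p * p^*%C) = 2 * p^*%C.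
  have := congr1 conjc e; rewrite !conjE => <-; ring.
have n3 : 1 + p * p^*%C != 0.
  rewrite (_ : _ + _ = (1 + sqmod p)%:C); last by rewrite mulcJ; cring.
  by apply/eqP => /ofRI /eqP; rewrite gt_eqF // oneD_sqmod.
apply: (mulIf n3).
rewrite -mulrA [X in _ * X](_ : _ = 1 + p * p^*%C - 2 * p^*%C * z); last first.
  by rewrite -e'; ring.
rewrite mulrBl e /point_reflection {1}/mobius cjN mulNr mulrN !opprK.
have n4 : 1 - p^*%C * mobius p z != 0 := n2.
have n5 : 1 - p^*%C * z + - (p^*%C * (z - p)) != 0.
  apply: contra_neq n4 => h; rewrite /mobius mulrA; apply: (mulIf n1).
  by rewrite mulrBl divfK // mul1r mul0r -h; ring.
rewrite /mobius; move: (p^*%C) n1 n5 n3 {e e' n2 n4} => p' n1 n5 n3.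
by field; rewrite ?n1 ?n5.
Qed.

(** The relation b (1 - k^* a) = k - a and its conjugate form a linear system; eliminating k^*
    leaves [kmid_eq]. *)
Lemma kmid_klein (R : realType) (p a b : R[i]) : disk p -> disk a -> disk b ->
  point_reflection p a = b -> kmid a b = klein p.
Proof.
move=> dp da db e; have := point_reflection_klein dp da; rewrite e.
move: (klein p) => k h.
have n0 : 1 - a * a^*%C * (b * b^*%C) != 0.
  rewrite (_ : _ - _ = (1 - sqmod a * sqmod b)%:C).
    by apply/eqP => /ofRI /eqP; rewrite gt_eqF // kmid_den.
  by rewrite !mulcJ rmorphB rmorphM rmorph1.
apply: (mulIf n0); rewrite kmid_eq //.
have {}h : k = a + b - a * b * k^*%C.
  transitivity ((k - a) + a); first by ring.
  by rewrite -h; ring.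
have h' : k^*%C + a^*%C * b^*%C * k = a^*%C + b^*%C.
  by have := congr1 conjc h; rewrite !conjE => ->; ring.
transitivity (a + b - a * b * (k^*%C + a^*%C * b^*%C * k)).
  by rewrite h'; ring.
by rewrite [in RHS]mulrBr mulr1 [X in _ = X - _]h; ring.
Qed.

Lemma point_reflection_hmid (R : realType) (a b : R[i]) : disk a -> disk b ->
  point_reflection (hmid a b) a = b.
Proof.
move=> da db; have [dh _ _] := hdist_hmid da db.
have dw := mobius_disk da db.
rewrite -[RHS](mobiusNK da db) -[LHS](mobiusNK da (disk_point_reflection dh da)).
congr (mobius _); rewrite mobius_point_reflection // mobius_self.
have d0 := disk0 R; have w1 : sqmod (mobius a b) < 1 := sqmod_lt1 dw.
have s2 : Num.sqrt (1 - cmod (mobius a b) ^+ 2) ^+ 2 = 1 - sqmod (mobius a b).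
  by rewrite -sqmodE sqr_sqrtr // subr_ge0 ltW.
have s0 := sqrtr_ge0 (1 - cmod (mobius a b) ^+ 2).
have dm : disk (mobius a (hmid a b)) by apply: mobius_disk.
have := point_reflection_klein dm d0; rewrite mulr0 !subr0 mulr1 => ->.
rewrite /hmid; move: (mobius a b) (Num.sqrt _) dw w1 s2 s0 => w s dw w1 s2 s0.
have s1 : 0 < 1 + s by rewrite ltr_pwDl.
have st : sqmod (w / (1 + s)%:C) = (1 - s) / (1 + s).
  have -> : w / (1 + s)%:C = w * ((1 + s)^-1)%:C by rewrite fmorphV.
  rewrite sqmodM (_ : sqmod _%:C = (1 + s) ^- 2); last first.
    by rewrite /sqmod /= expr0n addr0 exprVn.
  have -> : sqmod w = (1 - s) * (1 + s) by rewrite -[LHS](subKr 1) -s2; ring.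
  by field; rewrite gt_eqF.
have dt : disk (w / (1 + s)%:C).
  have s3 : 0 < s by rewrite lt_def s0 andbT -(@sqrf_eq0 _ s) s2 subr_eq0 eq_sym lt_eqF.
  by apply/diskE; rewrite st ltr_pdivrMr // mul1r; lra.
rewrite mobiusK // /klein st.
have -> : 2 / (1 + (1 - s) / (1 + s)) = 1 + s.
  have -> : 1 + (1 - s) / (1 + s) = 2 / (1 + s) by field; rewrite gt_eqF.
  by rewrite invf_div mulrCA divff ?mulr1 // pnatr_eq0.
rewrite divfK //; apply/eqP => /ofRI /eqP; rewrite gt_eqF //.
Qed.

Lemma hdist0 (R : realType) (y : R[i]) :
  hdist 0 y = ln ((1 + cmod y) / (1 - cmod y)).
Proof. by rewrite /hdist mobius_at0. Qed.

Lemma point_reflection0 (R : realType) (z : R[i]) : point_reflection 0 z = - z.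
Proof. by rewrite /point_reflection oppr0 !mobius_at0. Qed.

Lemma unit_direction (R : realType) (p : R[i]) :
  exists2 e : R[i], sqmod e = 1 & p = (cmod p)%:C * e.
Proof.
have [->|p0] := eqVneq p 0.
  by exists 1; rewrite ?cmod0 ?mul0r // /sqmod /= expr0n addr0 expr1n.
have n0 : cmod p != 0 by rewrite -sqrf_eq0 -sqmodE gt_eqF // sqmod_gt0.
exists (((cmod p)^-1)%:C * p); last first.
  by rewrite mulrA -rmorphM divff // mul1r.
rewrite sqmodM (_ : sqmod _%:C = (cmod p) ^- 2); last first.
  by rewrite /sqmod /= expr0n addr0 exprVn.
by rewrite sqmodE mulVf // expf_neq0.
Qed.

(** The orbit stays on the diameter through [p], at distance n ln E from 0, hence modulus tanh (n ln
    E / 2); the induction is the addition formula for tanh. *)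
Lemma iter_half_turns (R : realType) (p : R[i]) (n : nat) : disk p ->
  let E := ((1 + cmod p) / (1 - cmod p)) ^+ 2 in
  cmod (iter n (fun z => - point_reflection p z) 0) = (E ^+ n - 1) / (E ^+ n + 1).
Proof.
move=> dp /=; have r1 : cmod p < 1 := dp; have r0 := cmod_ge0 p.
have [e e1 pE] := unit_direction p; set r := cmod p in r0 r1 pE *; set E := _ ^+ 2.
have E1 : 1 <= E.
  apply: exprn_ege1; rewrite ler_pdivlMr ?subr_gt0 // mul1r; lra.
have En j : 1 <= E ^+ j by apply: exprn_ege1.
have Ep j : 0 < E ^+ j + 1 by have := En j; lra.
pose tau j := (E ^+ j - 1) / (E ^+ j + 1).
have tau0 j : 0 <= tau j by rewrite divr_ge0 ?subr_ge0 ?(ltW (Ep j)).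
have tau1 j : tau j < 1 by rewrite ltr_pdivrMr // mul1r; lra.
have ce (t : R) : 0 <= t -> cmod (- (t%:C * e)) = t.
  move=> t0; rewrite cmodN cmodM cmod_real //.
  have : cmod e ^+ 2 = 1 by rewrite -sqmodE.
  by move/eqP; rewrite sqrp_eq1 ?cmod_ge0 // => /eqP ->; rewrite mulr1.
suff -> : iter n (fun z => - point_reflection p z) 0 = - ((tau n)%:C * e) by exact: ce.
elim: n => [|n /= ->]; first by rewrite /tau expr0 subrr mul0r mul0r oppr0.
have dz : disk (- ((tau n)%:C * e)) by rewrite /disk /mkset ce.
have := point_reflection_klein dp dz; have kE : klein p = (2 * r / (1 + r ^+ 2))%:C * e.
  by rewrite /klein sqmodE -/r {1}pE; cring.
rewrite kE; set T := 2 * r / (1 + r ^+ 2); set t := tau n => h.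
have T0 : 0 <= T by rewrite divr_ge0 ?mulr_ge0 // addr_ge0 // sqr_ge0.
have tE : tau n.+1 = (T + t) / (1 + T * t).
  rewrite /t /tau /T exprS; move: (E ^+ n) (En n) (Ep n) => X X1 Xp.
  have r1' : 1 - r != 0 by rewrite gt_eqF // subr_gt0.
  rewrite /E; have r2 : 0 < 1 + r ^+ 2 by rewrite ltr_pwDl // sqr_ge0.
  have r3 : 0 < (1 + r) ^+ 2 * X + (1 - r) ^+ 2.
    by rewrite ltr_wpDr ?sqr_ge0 // mulr_gt0 ?exprn_gt0 //; lra.
  by field; rewrite !gt_eqF //=; lra.
have d0 : (1 + T * t)%:C != 0 :> R[i].
  apply/eqP => /ofRI /eqP; rewrite gt_eqF //.
  by rewrite ltr_pwDl // mulr_ge0 // tau0.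
have hden : 1 - (T%:C * e)^*%C * - (t%:C * e) = (1 + T * t)%:C.
  transitivity (1 + (T * t)%:C * (e * e^*%C)); first by rewrite !conjE [(T * t)%:C]rmorphM; ring.
  by rewrite mulcJ e1 mulr1; cring.
rewrite hden in h; congr (- _); apply: (mulIf d0); rewrite h tE.
rewrite mulrAC -rmorphM divfK; last by apply: contra_neq d0 => ->.
by cring.
Qed.

Lemma translation_lengthE (R : realType) (o M : R[i]) : disk o -> disk M ->
  let r := cmod (mobius o M) in
  translation_length o (point_reflection o \o point_reflection M)
    = ln (((1 + r) / (1 - r)) ^+ 2).
Proof.
move=> d0 dM r; set g := _ \o _; have dp := mobius_disk d0 dM.
have it n : disk (iter n g o) /\
    mobius o (iter n g o) = iter n (fun z => - point_reflection (mobius o M) z) 0.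
  elim: n => [|n [ih1 ih2]] /=; first by rewrite mobius_self.
  have dr := disk_point_reflection dM ih1.
  split; first exact: disk_point_reflection.
  rewrite mobius_point_reflection // mobius_self point_reflection0.
  by rewrite mobius_point_reflection // ih2.
set E := _ ^+ 2; have r1 : r < 1 := dp; have r0 : 0 <= r := cmod_ge0 _.
have E0 : 0 < E by rewrite exprn_gt0 // divr_gt0 //; lra.
have hd n : hdist o (iter n g o) = ln E *+ n.
  have [d e] := it n; rewrite -(hdist_isometry d0 d0 d) mobius_self e hdist0.
  rewrite iter_half_turns // -/r -/E -lnXn //; congr ln.
  have En : 0 < E ^+ n by rewrite exprn_gt0.
  by field; rewrite !gt_eqF //; lra.
apply/cvg_lim => //; apply: (@cvg_trans _ (ln E @[n --> \oo])); last exact: cvg_cst.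
(* For n = 0 the quotient is 0, so the sequence is constant only from 1 on. *)
apply: near_eq_cvg; near=> n.
rewrite hd -[ln E *+ n]mulr_natr mulfK ?pnatr_eq0 -?lt0n //.
by near: n; exact: nbhs_infty_gt.
Unshelve. all: by end_near.
Qed.

Lemma deficit_translation_length (R : realType) (o a b : R[i]) :
  disk o -> disk a -> disk b ->
  (1 + expR (translation_length o (point_reflection o \o point_reflection (hmid a b))))^-1
    = (1 - cmod (kmid (mobius o a) (mobius o b))) / 2.
Proof.
move=> d0 da db; have [dh _ _] := hdist_hmid da db.
have dm := mobius_disk d0 dh.
rewrite translation_lengthE // (@kmid_klein _ (mobius o (hmid a b))) //; last first.
- by rewrite -mobius_point_reflection // point_reflection_hmid.
- exact: mobius_disk.
- exact: mobius_disk.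
have r1 : cmod (mobius o (hmid a b)) < 1 := dm.
have r0 := cmod_ge0 (mobius o (hmid a b)).
rewrite lnK ?posrE ?exprn_gt0 ?divr_gt0 //; try lra.
have k0 : 0 <= 2 / (1 + sqmod (mobius o (hmid a b))).
  by rewrite divr_ge0 // ltW // oneD_sqmod.
rewrite /klein cmodM cmod_real // sqmodE.
(* With r = tanh (d / 2), both sides equal (1 - r)^2 / (2 (1 + r^2)). *)
move: (cmod _) r0 r1 => r r0 r1.
have h : 0 < 1 + r ^+ 2 by rewrite ltr_pwDl // sqr_ge0.
field; rewrite !gt_eqF //; nra.
Qed.

(** * The vertices of a symmetric region *)

Lemma orientE (R : realType) (a b z : R[i]) : orient a b z = cross (b - a) (z - a).
Proof. by rewrite /orient /cross !reimE; ring. Qed.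

Lemma orient_line (R : realType) (a b z d : R[i]) (t : R) :
  orient a b (z + t%:C * d) = orient a b z + t * cross (b - a) d.
Proof. by rewrite /orient /cross !reimE; ring. Qed.

Lemma orientN (R : realType) (a b z : R[i]) :
  orient (- a) (- b) (- z) = orient a b z.
Proof. by rewrite /orient /cross !reimE; ring. Qed.

Lemma orient_swap (R : realType) (a b z : R[i]) : orient a b z = - orient a z b.
Proof. by rewrite /orient /cross !reimE; ring. Qed.

Lemma orient_same (R : realType) (a b : R[i]) :
  [/\ orient a b a = 0, orient a b b = 0 & orient a a b = 0].
Proof. by split; rewrite /orient /cross !reimE; ring. Qed.

Lemma orient_antipode (R : realType) (a b : R[i]) : orient a b (- a) = 2 * cross a b.
Proof. by rewrite /orient /cross !reimE; ring. Qed.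

Lemma cross_parallel (R : realType) (x y d : R[i]) : d != 0 ->
  cross x d = 0 -> cross y d = 0 -> cross x y = 0.
Proof.
move=> d0 hx hy; apply: (mulfI (lt0r_neq0 (sqmod_gt0 d0))); rewrite mulr0.
transitivity (cross x d * re (y^*%C * d) - cross y d * re (x^*%C * d)).
  by rewrite /cross /sqmod !reimE; ring.
by rewrite hx hy !mul0r subrr.
Qed.

(** Constraints with values [g j] and slopes [c j] survive a common small step in either direction,
    provided the tight ones are flat. *)
Lemma uniform_step (R : realType) (I : finType) (g c : I -> R) :
  (forall j, 0 <= g j) -> (forall j, g j = 0 -> c j = 0) ->
  exists2 e : R, 0 < e <= 1 & forall j, e * `|c j| <= g j.
Proof.
move=> g0 gc; pose S := \sum_j `|c j| / g j. (* the terms with g j = 0 vanish *)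
have t0 j : 0 <= `|c j| / g j by rewrite divr_ge0.
have S0 : 0 <= S by apply: sumr_ge0.
have S1 : 0 < 1 + S by rewrite ltr_pwDl.
exists (1 + S)^-1; first by rewrite invr_gt0 S1 invf_le1 // lerDl.
move=> j; have [gj|gj] := eqVneq (g j) 0; first by rewrite gc // gj normr0 mulr0.
have gp : 0 < g j by rewrite lt_def gj g0.
rewrite mulrC ler_pdivrMr // -ler_pdivrMl // mulrC.
have : `|c j| / g j <= S by rewrite /S (bigD1 j) //= lerDl sumr_ge0.
lra.
Qed.


Lemma ordS_neq (n : nat) (i : 'I_n) : (1 < n)%N -> ordS i != i.
Proof.
move=> n1; apply/eqP => /(congr1 val) /=; case: i => a /= an.
have [h|h] : (a.+1 < n)%N \/ a.+1 = n by lia.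
  by rewrite modn_small //; lia.
by rewrite h modnn; lia.
Qed.

Lemma ordS2_neq (n : nat) (i : 'I_n) : (2 < n)%N -> ordS (ordS i) != i.
Proof.
move=> n2; apply/eqP => /(congr1 val) /=; case: i => a /= an.
have [h|h] : (a.+1 < n)%N \/ a.+1 = n by lia.
  rewrite (modn_small h); have [h2|h2] : (a.+2 < n)%N \/ a.+2 = n by lia.
    by rewrite modn_small //; lia.
  by rewrite h2 modnn; lia.
by rewrite h modnn modn_small; lia.
Qed.

(** On the line of side [j], the two adjacent sides confine [p] to the edge. Strictly inside it,
    vanishing for side [l] would put both endpoints of the edge on the line of [l], against strict
    convexity. *)
Lemma two_sides_vertex (R : realType) (n : nat) (k : 'I_n -> R[i]) (p : R[i])
    (j l : 'I_n) : (2 < n)%N ->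
  (forall i j, j != i -> j != ordS i -> 0 < orient (k i) (k (ordS i)) (k j)) ->
  (forall i, 0 <= orient (k i) (k (ordS i)) p) ->
  orient (k j) (k (ordS j)) p = 0 -> orient (k l) (k (ordS l)) p = 0 ->
  j != l -> exists i, k i = p.
Proof.
move=> n2 Hc Hp pj pl jl.
have sn (i : 'I_n) : ordS i != i by apply/ordS_neq/ltnW.
have ssn (i : 'I_n) : ordS (ordS i) != i by apply: ordS2_neq.
set e := k (ordS j) - k j.
have e0 : e != 0.
  apply: contraTneq (Hc j (ordS (ordS j)) (ssn j) _) => [h|].
    by rewrite orientE -/e h /cross conjc0 mul0r im0 ltxx.
  by rewrite (inj_eq (@ordS_inj n)) sn.
pose s := re ((p - k j) * e^*%C) / sqmod e.
have pE : p = k j + s%:C * e.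
  have se := lt0r_neq0 (sqmod_gt0 e0).
  have h : cross e (p - k j) = 0 by rewrite -pj orientE.
  have : (sqmod e)%:C * (p - k j) = (re ((p - k j) * e^*%C))%:C * e.
    move: h; rewrite /cross; move: (p - k j) (e) => q f h.
    have -> : (sqmod f)%:C * q = (f^*%C * q) * f by rewrite -mulcJ; ring.
    congr (_ * _); apply: complexP; rewrite ?h //.
    by rewrite !reimE; ring.
  move=> h2; rewrite -[LHS](subrK (k j)) addrC; congr (_ + _).
  apply: (@mulfI _ (sqmod e)%:C); first by apply/eqP => /ofRI /eqP; rewrite (negPf se).
  by rewrite h2 mulrA -rmorphM /s [sqmod e * _]mulrC divfK.
have lin i : orient (k i) (k (ordS i)) p =
    (1 - s) * orient (k i) (k (ordS i)) (k j)
    + s * orient (k i) (k (ordS i)) (k (ordS j)).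
  by rewrite pE /e /orient /cross !reimE; ring.
have s0 : 0 <= s.
  have := Hp (ord_pred j); rewrite lin ord_predK.
  have [_ -> _] := orient_same (k (ord_pred j)) (k j); rewrite mulr0 add0r.
  rewrite pmulr_lge0 //; have := Hc (ord_pred j) (ordS j); rewrite ord_predK; apply.
    by rewrite -(inj_eq (@ordS_inj n)) ord_predK ssn.
  exact: sn.
have s1 : s <= 1.
  have := Hp (ordS j); rewrite lin.
  have [-> _ _] := orient_same (k (ordS j)) (k (ordS (ordS j))); rewrite mulr0 addr0.
  by rewrite pmulr_lge0 ?subr_ge0 // Hc // eq_sym.
have [s0'|s0'] := eqVneq s 0.
  by exists j; rewrite pE s0' mul0r addr0.
have [s1'|s1'] := eqVneq s 1.
  by exists (ordS j); rewrite pE s1' mul1r /e addrC subrK.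
have {s0}s0 : 0 < s by rewrite lt_def s0'.
have {s1}s1 : 0 < 1 - s by rewrite subr_gt0 lt_def eq_sym s1'.
have ge0 i : 0 <= orient (k l) (k (ordS l)) (k i).
  have [a b _] := orient_same (k l) (k (ordS l)).
  have [->|h1] := eqVneq i l; first by rewrite a.
  by have [->|h2] := eqVneq i (ordS l); [rewrite b | apply/ltW/Hc].
have hA := mulr_ge0 (ltW s1) (ge0 j); have hB := mulr_ge0 (ltW s0) (ge0 (ordS j)).
have := pl; rewrite lin => hs.
have h1 : orient (k l) (k (ordS l)) (k j) = 0.
  by apply: (mulfI (lt0r_neq0 s1)); rewrite mulr0; lra.
have h2 : orient (k l) (k (ordS l)) (k (ordS j)) = 0.
  by apply: (mulfI (lt0r_neq0 s0)); rewrite mulr0; lra.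
have jE : j = ordS l.
  apply/eqP; apply/negPn/negP => h.
  by have := Hc l j jl h; rewrite h1 ltxx.
have : 0 < orient (k l) (k (ordS l)) (k (ordS j)).
  by apply: Hc; rewrite jE ?ssn ?sn.
by rewrite h2 ltxx.
Qed.

(* Otherwise - k i, lying on at most one side line, is the midpoint of a segment
   of the region, and so is k i by symmetry: but k i is extreme. *)
Lemma vertex_opposite (R : realType) (n : nat) (k : 'I_n -> R[i]) : (2 < n)%N ->
  (forall i, sqmod (k i) < 4^-1) ->
  (forall i j, j != i -> j != ordS i -> 0 < orient (k i) (k (ordS i)) (k j)) ->
  (forall x, sqmod x < 4^-1 -> (forall i, 0 <= orient (k i) (k (ordS i)) x) ->
     forall i, 0 <= orient (k i) (k (ordS i)) (- x)) ->
  forall i, exists j, k j = - k i.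
Proof.
move=> n2 hd Hc Hs i0; set p := - k i0.
have sn (i : 'I_n) : ordS i != i by apply/ordS_neq/ltnW.
have ssn (i : 'I_n) : ordS (ordS i) != i by apply: ordS2_neq.
have ge0 i j : 0 <= orient (k i) (k (ordS i)) (k j).
  have [a b _] := orient_same (k i) (k (ordS i)).
  have [->|h1] := eqVneq j i; first by rewrite a.
  by have [->|h2] := eqVneq j (ordS i); [rewrite b | apply/ltW/Hc].
have Hp : forall i, 0 <= orient (k i) (k (ordS i)) p := Hs _ (hd i0) (ge0^~ i0).
have en i : k (ordS i) - k i != 0.
  apply: contraTneq (Hc i (ordS (ordS i)) (ssn i) _) => [h|].
    by rewrite orientE h /cross conjc0 mul0r im0 ltxx.
  by rewrite (inj_eq (@ordS_inj n)) sn.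
apply: contrapT => nv.
(* A direction along the only side line through [p], or any direction if there is none. *)
have [d d0 dZ] : exists2 d, d != 0 & forall j,
    orient (k j) (k (ordS j)) p = 0 -> cross (k (ordS j) - k j) d = 0.
  have [[j pj]|h] := pselect (exists j, orient (k j) (k (ordS j)) p = 0); last first.
    by exists 1 => [|j pj]; [exact: oner_neq0 | case: h; exists j].
  exists (k (ordS j) - k j) => // l pl.
  have [->|lj] := eqVneq l j; first by rewrite /cross mulrC mulcJ imC.
  case: nv; apply: (two_sides_vertex n2 Hc Hp pj pl).
  by rewrite eq_sym.
have sp : 0 < 4^-1 - sqmod p by rewrite subr_gt0 sqmodN.
(* [None] is the constraint of staying in the open disk of radius 1/2; its slack is halved to keep
   the inequality strict. *)
pose g (j : option 'I_n) : R :=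
  if j is Some j then orient (k j) (k (ordS j)) p else (4^-1 - sqmod p) / 2.
pose c (j : option 'I_n) : R :=
  if j is Some j then cross (k (ordS j) - k j) d
  else 2 * `|re (p * d^*%C)| + sqmod d.
have [e /andP[e0 e1] he] : exists2 e : R, 0 < e <= 1 & forall j, e * `|c j| <= g j.
  apply: uniform_step => [[j|] /=|[j|] /=]; [exact: Hp| |exact: dZ|].
    by rewrite divr_ge0 // ltW.
  by move=> /eqP; rewrite mulf_eq0 invr_eq0 (gt_eqF sp) pnatr_eq0.
have inside (t : R) : `|t| = e -> forall i, 0 <= orient (k i) (k (ordS i)) (- (p + t%:C * d)).
  move=> te; apply: Hs => [|i]; last first.
    rewrite orient_line; have := he (Some i); rewrite /= -te -normrM.
    by rewrite ler_norml => /andP[+ _]; lra.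
  have := he None; rewrite /=.
  have D0 := sqmod_ge0 d; have N0 := normr_ge0 (re (p * d^*%C)).
  rewrite ger0_norm; last by rewrite addr_ge0 // mulr_ge0.
  have -> : sqmod (p + t%:C * d) = sqmod p + 2 * (t * re (p * d^*%C)) + t ^+ 2 * sqmod d.
    by rewrite /sqmod !reimE; ring.
  have : t * re (p * d^*%C) <= e * `|re (p * d^*%C)|.
    by rewrite -te -normrM ler_norm.
  have : t ^+ 2 * sqmod d <= e * sqmod d.
    apply: ler_wpM2r => //; rewrite -(@real_normK _ t) ?num_real // te expr2.
    by rewrite ler_piMl // ltW.
  move: (t * _) (t ^+ 2 * _) => A B; lra.
(* [k i0] plus and minus [e] times [d] both satisfy all side inequalities, so each side line through
   [k i0] is parallel to [d]; the two sides meeting there are not parallel. *)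
have flat i : orient (k i) (k (ordS i)) (k i0) = 0 -> cross (k (ordS i) - k i) d = 0.
  move=> hi; have h1 := inside e (gtr0_norm e0) i.
  have h2 := inside (- e) (etrans (normrN _) (gtr0_norm e0)) i.
  have E (t : R) : - (p + t%:C * d) = k i0 + (- t)%:C * d.
    by rewrite /p; cring.
  rewrite !E !orient_line hi !add0r opprK in h1 h2.
  apply: (mulfI (lt0r_neq0 e0)); rewrite mulr0; lra.
have [a1 b1 _] := orient_same (k i0) (k (ordS i0)).
have [_ b2 _] := orient_same (k (ord_pred i0)) (k i0).
have h1 := flat i0 a1; have h2 := flat (ord_pred i0).
rewrite ord_predK in h2.
have := cross_parallel d0 (h2 b2) h1.
have := Hc (ord_pred i0) (ordS i0); rewrite ord_predK orientE.
rewrite -(inj_eq (@ordS_inj n)) ord_predK => /(_ (ssn i0) (sn i0)).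
have -> : cross (k i0 - k (ord_pred i0)) (k (ordS i0) - k (ord_pred i0)) =
   cross (k i0 - k (ord_pred i0)) (k (ordS i0) - k i0).
  by rewrite /cross !reimE; ring.
by move=> h h'; rewrite h' ltxx in h.
Qed.

Definition cyc (n : nat) (n0 : (0 < n)%N) (j : nat) : 'I_n := Ordinal (ltn_pmod j n0).

Lemma ordS_cyc (n : nat) (n0 : (0 < n)%N) (j : nat) : ordS (cyc n0 j) = cyc n0 j.+1.
Proof. by apply: val_inj; rewrite /= -addn1 modnDml addn1. Qed.

Lemma cyc_val (n : nat) (n0 : (0 < n)%N) (i : 'I_n) : cyc n0 i = i.
Proof. by apply: val_inj; rewrite /= modn_small. Qed.

Lemma cyc_neq (n : nat) (n0 : (0 < n)%N) (i j : nat) :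
  (0 < j < n)%N -> cyc n0 (i + j) != cyc n0 i.
Proof.
move=> /andP[j0 jn]; apply/eqP => /(congr1 val) /= /eqP.
by rewrite -[X in _ == X %[mod _]]addn0 eqn_modDl mod0n modn_small // gtn_eqF.
Qed.

(** The antipodal map [s] on indices commutes with [ordS], hence adds a constant [c]. It is an
    involution, so 2 c is 0 modulo 2 m, and c = 0 would make all vertices 0. *)
Lemma vertex_shift (R : realType) (m : nat) (k : 'I_(2 * m) -> R[i])
    (n0 : (0 < 2 * m)%N) : (2 < 2 * m)%N ->
  (forall i j, j != i -> j != ordS i -> 0 < orient (k i) (k (ordS i)) (k j)) ->
  (forall i, exists j, k j = - k i) ->
  forall j, k (cyc n0 (j + m)) = - k (cyc n0 j).
Proof.
move=> n2 Hc Hv.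
have sn (i : 'I_(2 * m)) : ordS i != i by apply/ordS_neq/ltnW.
have ssn (i : 'I_(2 * m)) : ordS (ordS i) != i by apply: ordS2_neq.
have ge0 i j : 0 <= orient (k i) (k (ordS i)) (k j).
  have [a b _] := orient_same (k i) (k (ordS i)).
  have [->|h1] := eqVneq j i; first by rewrite a.
  by have [->|h2] := eqVneq j (ordS i); [rewrite b | apply/ltW/Hc].
have inj : injective k.
  move=> i j kij; apply/eqP; rewrite eq_sym; apply/negPn/negP => ji.
  have [a b c] := orient_same (k i) (k (ordS i)).
  have [jS|jS] := eqVneq j (ordS i); last first.
    by have := Hc i j ji jS; rewrite -kij a ltxx.
  have := Hc i (ordS j); rewrite jS ssn (inj_eq (@ordS_inj _)) sn => /(_ isT isT).
  by rewrite -jS -kij; have [_ _ ->] := orient_same (k i) (k (ordS j)); rewrite ltxx.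
have [s ks] := choice Hv.
(* Otherwise convexity at side [s i], read through the antipodal map, puts a vertex strictly right
   of side [i]. *)
have sS i : s (ordS i) = ordS (s i).
  apply/eqP/negPn/negP => h.
  have st : s (ordS i) != s i.
    apply: contraNneq (sn i) => e; apply/eqP/inj.
    by rewrite -[LHS]opprK -ks e ks opprK.
  have := Hc _ _ st h; rewrite orient_swap !ks oppr_gt0.
  rewrite -[k (ordS (s i))]opprK orientN -ks => h2.
  by have := ge0 i (s (ordS (s i))); lra.
set c := s (cyc n0 0).
have sc j : s (cyc n0 j) = cyc n0 (c + j).
  elim: j => [|j ih]; first by rewrite addn0 cyc_val.
  by rewrite -ordS_cyc sS ih ordS_cyc addnS.
have ss i : s (s i) = i by apply: inj; rewrite !ks opprK.
have c0 : (c != 0 :> nat)%N.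
  apply/eqP => c0; have e j : s (cyc n0 j) = cyc n0 j by rewrite sc c0.
  have z j : k (cyc n0 j) = 0.
    have := ks (cyc n0 j); rewrite e => /eqP; rewrite -subr_eq0 opprK -mulr2n.
    by rewrite -mulr_natr mulf_eq0 pnatr_eq0 orbF => /eqP.
  have : cyc n0 1 = cyc n0 0 by apply: inj; rewrite !z.
  by move/eqP; apply/negP; have := @cyc_neq _ n0 0 1; rewrite add0n; apply; lia.
have cm : (c : nat) = m.
  have : s (cyc n0 c) = cyc n0 0 by rewrite cyc_val ss.
  rewrite sc => /(congr1 val) /=; rewrite mod0n => /eqP/dvdnP[q hq].
  have cl := ltn_ord c; move: c0 => /eqP c0.
  case: q hq => [|[|q]] hq; first by lia.
    by lia.
  by nia.
by move=> j; rewrite -ks sc addnC cm.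
Qed.

Lemma hklein_surj (R : realType) (x : R[i]) : sqmod x < 4^-1 ->
  exists2 z, disk z & hklein z = x.
Proof.
move=> hx; set s := Num.sqrt (1 - 4 * sqmod x).
have p0 : 0 < 1 - 4 * sqmod x by lra.
have s0 : 0 < s by rewrite sqrtr_gt0.
have s2 : s ^+ 2 = 1 - 4 * sqmod x by rewrite sqr_sqrtr // ltW.
have s1 : 0 < 1 + s by rewrite ltr_pwDl // ltW.
have zE : sqmod ((2 / (1 + s))%:C * x) = (1 - s) / (1 + s).
  rewrite sqmodM (_ : sqmod _%:C = (2 / (1 + s)) ^+ 2); last first.
    by rewrite {1}/sqmod /= expr0n addr0.
  have -> : sqmod x = (1 - s) * (1 + s) / 4.
    by rewrite (_ : (1 - s) * _ = 1 - s ^+ 2); [rewrite s2; field | ring].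
  by field; rewrite gt_eqF.
exists ((2 / (1 + s))%:C * x).
  by apply/diskE; rewrite zE ltr_pdivrMr // mul1r; lra.
have e : (1 + (1 - s) / (1 + s))^-1 * (2 / (1 + s)) = 1.
  have -> : 1 + (1 - s) / (1 + s) = 2 / (1 + s) by field; rewrite gt_eqF.
  by rewrite mulVf // gt_eqF // divr_gt0.
by rewrite /hklein zE mulrA -rmorphM e mul1r.
Qed.

Lemma hklein_sqmod (R : realType) (z : R[i]) : disk z -> sqmod (hklein z) < 4^-1.
Proof.
move=> dz; have z1 := sqmod_lt1 dz; have z0 := oneD_sqmod z.
rewrite /hklein sqmodM (_ : sqmod _%:C = (1 + sqmod z) ^- 2); last first.
  by rewrite {1}/sqmod /= expr0n addr0 exprVn.
rewrite ltr_pdivrMl ?exprn_gt0 // -subr_gt0.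
have -> : (1 + sqmod z) ^+ 2 * 4^-1 - sqmod z = (1 - sqmod z) ^+ 2 / 4 by field.
by rewrite divr_gt0 // exprn_gt0 // subr_gt0.
Qed.

Lemma hklein_inj (R : realType) (a b : R[i]) :
  disk a -> disk b -> hklein a = hklein b -> a = b.
Proof.
move=> da db h; have a0 := oneD_sqmod a; have b0 := oneD_sqmod b.
have ne (t : R) : 0 < t -> t%:C != 0 :> R[i].
  by move=> t0; apply/eqP => /ofRI /eqP; rewrite gt_eqF.
have e : (1 + sqmod b)%:C * a = (1 + sqmod a)%:C * b.
  have /(congr1 (fun x => ((1 + sqmod a) * (1 + sqmod b))%:C * x)) := h.
  rewrite /hklein !mulrA -!rmorphM.
  by rewrite mulrAC divff ?gt_eqF // mul1r mulfK ?gt_eqF.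
suff s : sqmod a = sqmod b by apply: (mulfI (ne _ b0)); rewrite e s.
have := congr1 (@sqmod R) e; rewrite !sqmodM.
have sC (t : R) : sqmod t%:C = t ^+ 2 by rewrite /sqmod /= expr0n addr0.
rewrite !sC => /eqP; rewrite -subr_eq0.
have -> : (1 + sqmod b) ^+ 2 * sqmod a - (1 + sqmod a) ^+ 2 * sqmod b =
   (sqmod a - sqmod b) * (1 - sqmod a * sqmod b) by ring.
by rewrite mulf_eq0 (gt_eqF (kmid_den da db)) orbF subr_eq0 => /eqP.
Qed.

Lemma hside_orient (R : realType) (a b z : R[i]) : disk a -> disk b -> disk z ->
  ((0 < hside a b z) = (0 < orient (hklein a) (hklein b) (hklein z))) *
  ((0 <= hside a b z) = (0 <= orient (hklein a) (hklein b) (hklein z))).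
Proof.
move=> da db dz; have [c c0 ->] := hside_hklein da db dz.
by rewrite pmulr_rgt0 // pmulr_rge0.
Qed.

(** The symmetry hypothesis concerns the region, not its vertices. In the coordinate [hklein] after
    [mobius o], sides are straight and the half-turn about [o] is negation, so [vertex_opposite] and
    [vertex_shift] apply. *)
Lemma symmetric_vertices (R : realType) (m : nat) (v : 'I_(2 * m) -> R[i]) (o : R[i])
    (n0 : (0 < 2 * m)%N) :
  convex_polygon v -> symmetric_about (polygon_region v) o ->
  forall j, mobius o (v (cyc n0 (j + m))) = - mobius o (v (cyc n0 j)).
Proof.
move=> [n2 dv cv] [d0 sym] j; pose u i := mobius o (v i).
have du i : disk (mobius o (v i)) by apply: mobius_disk.
have cu i l : l != i -> l != ordS i ->
    0 < orient (hklein (u i)) (hklein (u (ordS i))) (hklein (u l)).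
  by move=> li lS; rewrite /u -hside_orient // hside_mobius // cv.
have opp : forall i, exists l, hklein (u l) = - hklein (u i).
  apply: vertex_opposite => //; first by move=> i; apply: hklein_sqmod; apply: du.
  move=> x /hklein_surj[z dz <-] hz i.
  have dz' : disk (mobius (- o) z) by apply: mobius_disk => //; apply: diskN.
  have Pz : polygon_region v (mobius (- o) z).
    split=> // l; rewrite -(hside_mobius d0) // mobiusK // hside_orient //.
    exact: hz.
  have [_ /(_ i)] : polygon_region v (point_reflection o (mobius (- o) z)).
    by rewrite -[polygon_region v]sym; apply: imageP.
  have dr := disk_point_reflection d0 dz'.
  rewrite -(hside_mobius d0) // mobius_point_reflection // mobius_self mobiusK //.
  rewrite point_reflection0 hside_orient ?hkleinN //; exact: diskN.
apply: hklein_inj; [exact: du|exact/diskN/du|].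
by rewrite hkleinN; apply: (vertex_shift n0 n2 cu opp).
Qed.

(** * From sums over the sides to the set of translations *)

Lemma fsbig_range_le (R : realType) (I : finType) (T : choiceType) (h : I -> T)
    (F : T -> R) : (forall x, 0 <= F x) ->
  \sum_(x \in range h) F x <= \sum_i F (h i).
Proof.
move=> F0.
have fin : finite_set (range h) by apply: finite_image; exact: finite_finset.
rewrite fsbig_finite //= (perm_big (undup [seq h i | i <- index_enum I])); last first.
  apply: uniq_perm; [exact: finmap.fset_uniq | exact: undup_uniq|].
  move=> x; rewrite in_fset_set // mem_undup; apply/idP/mapP.
    by rewrite inE => -[i _ <-]; exists i; rewrite ?mem_index_enum.
  by move=> [i _ ->]; rewrite inE; exists i.
(* Two indices may have the same image; removing duplicates only drops nonnegative terms. *)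
rewrite -(big_map h xpredT F).
elim: (map h _) => [|x s ih] /=; first by rewrite !big_nil.
rewrite [leRHS]big_cons; case: ifP => _; last by rewrite big_cons lerD2l.
by apply: (le_trans ih); rewrite lerDr.
Qed.

Lemma kmidN (R : realType) (a b : R[i]) : kmid (- a) (- b) = - kmid a b.
Proof. by rewrite /kmid !sqmodN; ring. Qed.

Lemma sum_double_period (R : realType) (m : nat) (G : nat -> R) :
  (forall i, G (i + m)%N = G i) -> \sum_(i < 2 * m) G i = (\sum_(i < m) G i) *+ 2.
Proof.
move=> H; rewrite mul2n -addnn big_split_ord /= mulr2n; congr (_ + _).
by apply: eq_bigr => i _; rewrite addnC H.
Qed.

Theorem theorem4 (R : realType) (m : nat) (v : 'I_(2 * m) -> R[i]) (o : R[i])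
    (hP : convex_polygon v)
    (hsym : symmetric_about (polygon_region v) o)
    (hcycle : cycle_condition v) :
  \sum_(g \in side_translations v o)
    (1 + expR (translation_length o g))^-1 < 1.
Proof.
have [n2 dv cv] := hP; have [d0 _] := hsym; have [k k1 [heven hodd]] := hcycle.
have m1 : (1 < m)%N by lia.
have n0 : (0 < 2 * m)%N by lia.
pose u j := mobius o (v (cyc n0 j)).
have hd j : disk (u j) by apply: mobius_disk.
have hs j : u (j + m)%N = - u j by apply: symmetric_vertices.
have hside_gt0 i j : cyc n0 j != cyc n0 i -> cyc n0 j != cyc n0 i.+1 ->
    0 < hside (u i) (u i.+1) (u j).
  by move=> ji jS; rewrite /u hside_mobius // -ordS_cyc cv // ordS_cyc.
(* The vertex opposite to [u i] is [- u i]; that it lies left of side [i] means that 0 does. *)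
have hp i : 0 < im ((u i)^*%C * u i.+1).
  have : 0 < hside (u i) (u i.+1) (u (i + m)%N).
    apply: hside_gt0; first by apply: cyc_neq; lia.
    by rewrite (_ : i + m = i.+1 + m.-1)%N; [apply: cyc_neq; lia | lia].
  rewrite hside_orient // hs hkleinN.
  by rewrite orient_antipode pmulr_rgt0 // cross_hklein pmulr_lgt0 // invr_gt0 mulr_gt0 ?oneD_sqmod.
have hw : \sum_(i < m) argu ((u i)^*%C * u i.+1) = pi.
  apply: winding => // i j i1 j1 ji jS; apply: hside_gt0.
    by apply/eqP => /(congr1 val) /=; rewrite !modn_small //; lia.
  by apply/eqP => /(congr1 val) /=; rewrite !modn_small //; lia.
have ha : \sum_(i < 2 * m) hangle (u i) (u i.+1) (u i.+2) = 4 * pi / k%:R.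
  rewrite (eq_bigr (fun i => interior_angle v (ordS i))); last first.
    move=> i _; rewrite /interior_angle ordSK /u -!ordS_cyc cyc_val.
    exact: hangle_mobius.
  transitivity (\sum_(i < 2 * m) interior_angle v i).
    by rewrite [RHS](reindex_inj (@ordS_inj _)).
  rewrite (bigID (fun i : 'I_(2 * m) => odd i)) /= heven hodd; lra.
(* Over the whole polygon, twice the turning is 2 pi + 4 pi / k: central angles plus interior
   angles. Half of the boundary carries half of the turning. *)
have ht : turning u m = pi / 2 + pi / k%:R.
  have hc i : 0 < hside (u i.+1) (u i.+2) (u i).
    apply: hside_gt0; rewrite eq_sym.
      by rewrite -(addn1 i); apply: cyc_neq; lia.
    by rewrite -(addn2 i); apply: cyc_neq; lia.
  have per i : u (i + 2 * m)%N = u i by rewrite mul2n -addnn addnA !hs opprK.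
  have := polygon_turning hd hp hc (per 0%N) (per 1%N).
  rewrite ha (sum_double_period (G := fun i => argu ((u i)^*%C * u i.+1))); last first.
    by move=> i; rewrite -addSn !hs cjN mulrNN.
  rewrite hw /turning (sum_double_period
    (G := fun i => pi / 2 + argr (1 - (u i)^*%C * u i.+1))) -/(turning u m).
    lra.
  by move=> i; rewrite -addSn !hs cjN mulrNN.
have := symmetric_deficit m1 k1 hd (hs 0%N) hp ht.
rewrite big_map -[m in iota _ m]subn0 big_mkord => hlt.
apply: le_lt_trans hlt.
apply: le_trans (fsbig_range_le _ _) _ => [g|].
  by rewrite invr_ge0 addr_ge0 // expR_ge0.
(* Each side contributes half a deficit and opposite sides contribute equally, so the sum is that of
   the deficits of half of the boundary. *)
rewrite (eq_bigr (fun i : 'I_(2 * m) => (1 - cmod (kmid (u i) (u i.+1))) / 2)).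
  rewrite (sum_double_period (G := fun i => (1 - cmod (kmid (u i) (u i.+1))) / 2)).
    rewrite -mulr_suml -[leLHS]mulr_natr divfK ?pnatr_eq0 //.
    by rewrite le_eqVlt; apply/orP; left; apply/eqP/eq_bigr => i _; rewrite cmodN.
  by move=> i; rewrite -addSn !hs kmidN cmodN.
move=> i _; rewrite /side_translation deficit_translation_length //.
by rewrite /u -ordS_cyc cyc_val.
Qed.
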